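(* Let $d=2s$ be even, $\mathcal{A}\in\mathrm{S}^d(\mathbb{R}^2)$, $T=\begin{pmatrix}1&1\\0&1\end{pmatrix}$, and $y=(y_0,\dots,y_{2s})=\mathfrak{B}(\mathscr{L}_T(\mathcal{A}))$. Assume $H_1(y)\succeq0$, $H_2(y)\succeq0$ and $y_0>0$, and let $r=\operatorname{rank}H_1(y)$ (so $r\le s+1$). Define $$l=z^T M^{\dagger} z,\qquad u=y_{2s}-w^T N^{\dagger} w,$$ where $z=(y_{s+1},\dots,y_{2s})^T$, $M=(y_{i+j+1})_{0\le i,j\le s-1}$, $w=(y_s-y_{s+1},\,y_{s+1}-y_{s+2},\dots,y_{2s-1}-y_{2s})^T$, $N=(y_{i+j}-y_{i+j+1})_{0\le i,j\le s-1}$, and $^\dagger$ denotes the Moore–Penrose pseudoinverse. Then: (i) If $r\le s$, the linear system $\sum_{j=0}^{r-1}y_{i+j}g_j=y_{i+r}$ ($i=0,1,\dots,2s-r$) in unknowns $g_0,\dots,g_{r-1}$ has a unique solution. If $r=s+1$, then, setting $y_{2s+1}:=l$, the linear system $\sum_{j=0}^{s}y_{i+j}g_j=y_{i+s+1}$ ($i=0,1,\dots,s$) in unknowns $g_0,\dots,g_s$ has a unique solution. (ii) With $g_0,\dots,g_{r-1}$ the solution from (i), the polynomial $g(x)=g_0+g_1x+\cdots+g_{r-1}x^{r-1}-x^r$ has $r$ roots $x_1,\dots,x_r$ which are all distinct and belong to $[0,1]$, and there exists a unique $(\lambda_1,\dots,\lambda_r)$ with all $\lambda_i>0$ satisfying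 $y=\lambda_1[x_1]_d+\cdots+\lambda_r[x_r]_d$. Consequently $$\mathcal{A}=\begin{pmatrix}a_1\\ b_1\end{pmatrix}^{\otimes d}+\cdots+\begin{pmatrix}a_r\\ b_r\end{pmatrix}^{\otimes d},\quad a_i=\lambda_i^{1/d}(1-x_i)\ge0,\ b_i=\lambda_i^{1/d}x_i\ge0.$$ (iii) If $r\le s$, the representing measure for $y$ is unique. If $r=s+1$, the $r$-atomic representing measure for $y$ supported in $[0,1]$ is unique if and only if $l=u$. (iv) The cp-rank of $\mathcal{A}$ is $r$. If $r\le s$, the cp-rank decomposition of $\mathcal{A}$ is unique; if $r=s+1$, it is unique if and only if $l=u$.
   Context: $\mathrm{S}^d(\mathbb{R}^2)$ is the space of real symmetric tensors of order $d$ and dimension $2$; $v^{\otimes d}$ has entries $v_{i_1}\cdots v_{i_d}$. $\mathscr{L}_T$ is the linear map $(\mathscr{L}_T\mathcal{X})_{i_1\dots i_d}=\sum_{j_1,\dots,j_d}T_{i_1j_1}\cdots T_{i_dj_d}\mathcal{X}_{j_1\dots j_d}$. For $\mathcal{X}\in\mathrm{S}^d(\mathbb{R}^2)$, $\mathfrak{B}(\mathcal{X})=(x_0,\dots,x_d)$ with $x_k=\mathcal{X}_{i_1\dots i_d}$ whenever $i_1+\cdots+i_d-d=k$. $[t]_d:=(1,t,\dots,t^d)$. $X\succeq0$ means positive semidefinite. With indices from $0$: $H_1(y)=(y_{i+j})_{0\le i,j\le s}$ and $H_2(y)=(y_{i+j+1}-y_{i+j+2})_{0\le i,j\le s-1}$.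 A representing measure for $y=(y_0,\dots,y_d)$ is a Borel measure $\mu$ on $\mathbb{R}$ with $y_k=\int x^k\,d\mu$ for $k=0,\dots,d$; it is $r$-atomic if its support has exactly $r$ points. A cp-decomposition of $\mathcal{A}$ is an expression $\mathcal{A}=\sum_{i=1}^r v_i^{\otimes d}$ with $v_i\in\mathbb{R}^2_+$; the cp-rank is the smallest such $r$, and a cp-decomposition of that length is a cp-rank decomposition (uniqueness is up to reordering of summands). *)

(* Defs.v *)
From HB Require Import structures.
From mathcomp Require Import all_boot all_order all_fingroup all_algebra.
From mathcomp Require Import all_classical all_reals all_analysis.
Set Implicit Arguments. Unset Strict Implicit. Unset Printing Implicit Defensive.
Import Order.TTheory GRing.Theory Num.Theory.
Local Open Scope ring_scope.
Local Open Scope classical_set_scope.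

(* Real tensors of order d and dimension 2: entries indexed by multi-indices
   i : 'I_d -> 'I_2 (index values 0,1 stand for the paper's 1,2). *)
Notation tensor R d := {ffun {ffun 'I_d -> 'I_2} -> R}.

Definition symmetric_tensor (R : Type) (d : nat) (X : tensor R d) : Prop :=
  forall (s : {perm 'I_d}) (i : {ffun 'I_d -> 'I_2}),
    X [ffun k => i (s k)] = X i.

Definition tpow (R : comNzRingType) (d : nat) (v : 'cV[R]_2) : tensor R d :=
  [ffun i : {ffun 'I_d -> 'I_2} => \prod_(k < d) v (i k) 0].

Definition LT (R : comNzRingType) (d : nat) (T : 'M[R]_2) (X : tensor R d)
  : tensor R d :=
  [ffun i : {ffun 'I_d -> 'I_2} => \sum_(j : {ffun 'I_d -> 'I_2})
                (\prod_(k < d) T (i k) (j k)) * X j].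

Definition Tmat (R : nzRingType) : 'M[R]_2 :=
  \matrix_(i < 2, j < 2) (if (i <= j)%N then 1 else 0).

(* canonical multi-index with exactly k entries equal to the second index
   (i.e. i_1 + ... + i_d - d = k in the paper's 1-based convention) *)
Definition idx (d k : nat) : {ffun 'I_d -> 'I_2} :=
  [ffun m : 'I_d => if (m < k)%N then ord_max else ord0].

(* B(X) = (x_0, ..., x_d), as a sequence nat -> R (only k <= d is relevant) *)
Definition Bvec (R : Type) (d : nat) (X : tensor R d) : nat -> R :=
  fun k => X (idx d k).

Definition H1 (R : nzRingType) (s : nat) (y : nat -> R) : 'M[R]_s.+1 :=
  \matrix_(i, j) y (i + j)%N.
Definition H2 (R : nzRingType) (s : nat) (y : nat -> R) : 'M[R]_s :=
  \matrix_(i, j) (y (i + j + 1)%N - y (i + j + 2)%N).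

Definition psd (R : numDomainType) (n : nat) (A : 'M[R]_n) : Prop :=
  A^T = A /\ forall v : 'cV[R]_n, 0 <= (v^T *m A *m v) 0 0.

(* Moore--Penrose pseudoinverse (real matrices): the unique X with the four
   Penrose conditions; defined by choice. *)
Definition penrose (R : nzRingType) (n : nat) (A X : 'M[R]_n) : Prop :=
  [/\ A *m X *m A = A, X *m A *m X = X, (A *m X)^T = A *m X
    & (X *m A)^T = X *m A].
Definition pinv (R : realType) (n : nat) (A : 'M[R]_n) : 'M[R]_n :=
  xget 0 [set X | penrose A X].

Definition Mmat (R : nzRingType) (s : nat) (y : nat -> R) : 'M[R]_s :=
  \matrix_(i, j) y (i + j + 1)%N.
Definition Nmat (R : nzRingType) (s : nat) (y : nat -> R) : 'M[R]_s :=
  \matrix_(i, j) (y (i + j)%N - y (i + j + 1)%N).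
Definition zvec (R : nzRingType) (s : nat) (y : nat -> R) : 'cV[R]_s :=
  \col_i y (s + 1 + i)%N.
Definition wvec (R : nzRingType) (s : nat) (y : nat -> R) : 'cV[R]_s :=
  \col_i (y (s + i)%N - y (s + i + 1)%N).
Definition lval (R : realType) (s : nat) (y : nat -> R) : R :=
  ((zvec s y)^T *m pinv (Mmat s y) *m zvec s y) 0 0.
Definition uval (R : realType) (s : nat) (y : nat -> R) : R :=
  y (2 * s)%N - ((wvec s y)^T *m pinv (Nmat s y) *m wvec s y) 0 0.

Definition yext (R : realType) (s : nat) (y : nat -> R) : nat -> R :=
  fun k => if k == (2 * s).+1 then lval s y else y k.

Definition solves_sys (R : nzRingType) (yy : nat -> R) (r m : nat)
  (g : 'rV[R]_r) : Prop :=
  forall i : nat, (i <= m)%N ->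
    \sum_(j < r) yy (i + j)%N * g 0 j = yy (i + r)%N.

Definition gpoly (R : nzRingType) (r : nat) (g : 'rV[R]_r) : {poly R} :=
  \sum_(j < r) g 0 j *: 'X^j - 'X^r.

Definition representing (R : realType) (d : nat) (y : nat -> R)
  (mu : {measure set R -> \bar R}) : Prop :=
  forall k : nat, (k <= d)%N ->
    mu.-integrable setT (fun t : R => (t ^+ k)%:E) /\
    (\int[mu]_t (t ^+ k)%:E = (y k)%:E)%E.

Definition atomic (R : realType) (r : nat) (mu : {measure set R -> \bar R})
  : Prop :=
  exists x : 'I_r -> R, injective x /\
    mu (~` range x) = 0%E /\ forall i, (0 < mu [set x i])%E.

Definition supported01 (R : realType) (mu : {measure set R -> \bar R}) : Prop :=
  mu (~` `[0, 1]%classic) = 0%E.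

Definition same_measure (R : realType) (mu1 mu2 : {measure set R -> \bar R})
  : Prop := forall A : set R, measurable A -> mu1 A = mu2 A.

Definition cp_dec (R : realType) (d m : nat) (A : tensor R d)
  (v : 'I_m -> 'cV[R]_2) : Prop :=
  (forall i, 0 <= v i 0 0 /\ 0 <= v i 1 0) /\ A = \sum_(i < m) tpow d (v i).

Definition cp_rank_is (R : realType) (d : nat) (A : tensor R d) (r : nat)
  : Prop :=
  (exists v : 'I_r -> 'cV[R]_2, cp_dec A v) /\
  forall (m : nat) (v : 'I_m -> 'cV[R]_2), cp_dec A v -> (r <= m)%N.

Definition cp_dec_unique (R : realType) (d r : nat) (A : tensor R d) : Prop :=
  forall v w : 'I_r -> 'cV[R]_2, cp_dec A v -> cp_dec A w ->
    exists s : {perm 'I_r}, forall i, w i = v (s i).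

(* Main.v *)
Require Import Defs.
From HB Require Import structures.
From mathcomp Require Import all_boot all_order all_fingroup all_algebra.
From mathcomp Require Import ring lra zify complex.
From mathcomp Require Import all_classical all_reals all_analysis measurable_realfun.
Set Implicit Arguments.
Unset Strict Implicit.
Unset Printing Implicit Defensive.
Import Order.TTheory GRing.Theory Num.Theory.
Local Open Scope ring_scope.
Local Open Scope classical_set_scope.

(** A moment sequence [y] is studied through the functional [mom y] on polynomials that sends ['X^k] to [y k]. If [r] is the rank of [H1], this functional is positive definite in degree below [r], and there is a monic [p] of degree [r] orthogonal to all lower degrees. For [r <= s] the kernel of [H1] contains [p], and positivity of [H2] makes this kernel stable under multiplication by ['X]. For [r = s.+1] one takes ['X * q] or [('X - 1) * q], where [q] is orthogonal for the weight ['X] or [1 - 'X]; orthogonality of [p] to ['X^s] then amounts to prescribing the next moment as [l] or [u]. Gauss quadrature at the roots of [p] gives the atoms.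

Uniqueness rests on two facts. Two [r]-atomic quadratures with the same moments up to order [2r - 1] have equal nodal polynomials, since the difference of these is orthogonal to itself. Any quadrature with nodes between 0 and 1 has its moment of order [2s + 1] between [l] and [u], and both bounds are attained. *)

(* A non-real root [a + ib] would make [('X - a)^2 + b^2] divide [p], and a double real root is the case [b = 0]. *)
Lemma no_square_factor_splits (R : rcfType) (p : {poly R}) :
  p \is monic ->
  (forall a b h, p <> h * (('X - a%:P) ^+ 2 + (b ^+ 2)%:P)) ->
  exists rs : seq R, uniq rs /\ p = \prod_(a <- rs) ('X - a%:P).
Proof.
move=> pmon nosq.
set f := real_complex R.
have [rs prs] := closed_field_poly_normal (map_poly f p).
have rootreal z : z \in rs -> exists a, z = f a.
  case: z => a b zrs.
  have [b0|b0] := eqVneq b 0; first by exists a; rewrite b0.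
  exfalso.
  pose q := ('X - a%:P) ^+ 2 + (b ^+ 2)%:P : {poly R}.
  have rz : root (map_poly f p) (a +i* b)%C.
    by rewrite prs rootZ ?root_prod_XsubC// lead_coef_map/= (monicP pmon) rmorph1 oner_neq0.
  have qz : (map_poly f q).[(a +i* b)%C] = 0.
    rewrite /q rmorphD rmorphXn/= rmorphB/= map_polyX !map_polyC/= !hornerE/=.
    apply/eqP; rewrite eq_complex/= ; apply/andP; split; apply/eqP => /=; ring.
  have sq : size q = 3%N.
    rewrite /q size_polyDl ?size_exp_XsubC// size_polyC; by case: (_ != 0).
  have lq : lead_coef q = 1.
    rewrite /q lead_coefDl; last by rewrite size_exp_XsubC size_polyC; case: (_ != 0).
    by rewrite lead_coef_exp lead_coefXsubC expr1n.
  have sr : (size (modp p q) <= 2)%N.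
    have := ltn_modp p q; rewrite -size_poly_eq0 sq ltnS; by move=> ->.
  have eqr : modp p q = (modp p q)`_1 *: 'X + ((modp p q)`_0)%:P.
    apply/polyP => i; rewrite coefD coefZ coefX coefC.
    case: i => [|[|i]]/=; rewrite ?mulr0 ?mulr1 ?add0r ?addr0//.
    by rewrite nth_default// (leq_trans sr).
  have : (map_poly f (modp p q)).[(a +i* b)%C] = 0.
    move: rz; rewrite /root {1}(divp_eq p q) rmorphD rmorphM/= hornerD hornerM qz.
    by rewrite mulr0 add0r => /eqP.
  rewrite eqr rmorphD/= map_polyZ map_polyX map_polyC/= !hornerE/=.
  set c := (modp p q)`_1; set e := (modp p q)`_0.
  move/eqP; rewrite eq_complex/= => /andP[/eqP h1 /eqP h2].
  (* The value of the remainder at [a + ib] has imaginary part [c * b] with [b] nonzero; its real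
     part then reduces to [e]. *)
  have c0 : c = 0.
    move: h2; rewrite mul0r !addr0 => /eqP; rewrite mulf_eq0 (negbTE b0) orbF.
    by move=> /eqP.
  have e0 : e = 0 by move: h1; rewrite c0 !mul0r subr0 add0r.
  apply: (nosq a b (divp p q)).
  by rewrite {1}(divp_eq p q) eqr -/c -/e c0 e0 scale0r polyC0 !addr0.
have [ss ssE] : exists ss, rs = map f ss.
  elim: (rs) rootreal => [|z s IH] H; first by exists [::].
  have [a ->] := H z (mem_head _ _).
  have [|ss ->] := IH; first by move=> w ws; apply: H; rewrite inE ws orbT.
  by exists (a :: ss).
have pss : p = \prod_(a <- ss) ('X - a%:P).
  apply: (map_poly_inj f).
  rewrite prs lead_coef_map/= (monicP pmon) rmorph1 scale1r ssE big_map rmorph_prod/=.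
  by apply: eq_bigr => a _; rewrite rmorphB/= map_polyX map_polyC.
exists ss; split => //.
apply/negbNE/negP => /uniqPn -/(_ 0)[i [j [ij jss eij]]].
have := cat_take_drop i ss; rewrite (drop_nth 0 (ltn_trans ij jss)) => E.
have : nth 0 ss i \in drop i.+1 ss.
  rewrite eij -(subnK ij) addnC -nth_drop mem_nth// size_drop ltn_sub2r//.
  exact: leq_ltn_trans jss.
move=> /splitPr; move: E => /[swap] -[s1 s2] E.
apply: (nosq (nth 0 ss i) 0 ((\prod_(a <- take i ss) ('X - a%:P)) *
   (\prod_(a <- s1) ('X - a%:P)) * (\prod_(a <- s2) ('X - a%:P)))).
rewrite expr0n/= addr0 {1}pss -{1}E !big_cat/= !big_cons !big_cat/= big_cons.
ring.
Qed.

(** * The moment functional: linearity, definiteness, orthogonality *)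

Section MomentFunctional.
Variable R : realType.
Implicit Types (y : nat -> R) (p f h : {poly R}).

Definition mom y p : R := \sum_(i < size p) p`_i * y i.

Lemma mom_widen y p n : (size p <= n)%N -> mom y p = \sum_(i < n) p`_i * y i.
Proof.
move=> pn; rewrite /mom (big_ord_widen _ (fun i => p`_i * y i) pn).
rewrite [RHS](bigID (fun i : 'I_n => (i < size p)%N))/= [X in _ + X]big1 ?addr0//.
by move=> i; rewrite -leqNgt => /(nth_default 0) ->; rewrite mul0r.
Qed.

Fact mom_linear y : linear_for *%R (mom y).
Proof.
move=> c p f; set n := maxn (size p) (size f).
have pn : (size p <= n)%N by exact: leq_maxl.
have fn : (size f <= n)%N by exact: leq_maxr.
rewrite (mom_widen y pn) (mom_widen y fn) (@mom_widen _ _ n); last first.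
  apply: leq_trans (size_polyD _ _) _; rewrite geq_max fn andbT.
  exact: leq_trans (size_scale_leq _ _) pn.
rewrite mulr_sumr -big_split/=; apply: eq_bigr => i _.
by rewrite coefD coefZ mulrDl mulrA.
Qed.

HB.instance Definition _ y :=
  GRing.isLinear.Build R {poly R} R *%R (mom y) (mom_linear y).

Lemma momD y : {morph mom y : p f / p + f}.
Proof. exact: raddfD. Qed.

Lemma momB y : {morph mom y : p f / p - f}.
Proof. exact: raddfB. Qed.

Lemma momZ y c p : mom y (c *: p) = c * mom y p.
Proof. by rewrite -[c *: p]addr0 mom_linear raddf0 addr0. Qed.

Lemma momXn y k : mom y 'X^k = y k.
Proof.
rewrite (@mom_widen _ _ k.+1) ?size_polyXn// big_ord_recr/= coefXn eqxx mul1r.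
rewrite big1 ?add0r// => i _; rewrite coefXn.
by rewrite (ltn_eqF (ltn_ord i)) mul0r.
Qed.

Lemma eq_mom y y' n p : (forall k, (k < n)%N -> y k = y' k) ->
  (size p <= n)%N -> mom y p = mom y' p.
Proof.
by move=> yy' pn; apply: eq_bigr => i _; rewrite yy'// (leq_trans _ pn).
Qed.

Lemma mom_quadrature y n N (x w : 'I_n -> R) p :
  (forall k, (k < N)%N -> y k = \sum_i w i * x i ^+ k) ->
  (size p <= N)%N -> mom y p = \sum_i w i * p.[x i].
Proof.
move=> yE pN; rewrite (mom_widen y pN).
under eq_bigr => k _ do rewrite yE// mulr_sumr.
rewrite exchange_big/=; apply: eq_bigr => i _.
rewrite (horner_coef_wide _ pN) mulr_sumr; apply: eq_bigr => k _.
by rewrite mulrCA.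
Qed.

(** On coefficient vectors this is positive definiteness of the [n] by [n] Hankel matrix of [y]; the
    polynomial form allows factors such as ['X] to be moved around. *)
Definition posdef y n := forall f, f != 0 -> (size f <= n)%N -> 0 < mom y (f ^+ 2).

Definition orth y p n := forall h, (size h <= n)%N -> mom y (p * h) = 0.

Lemma orthP y p n : (forall i, (i < n)%N -> mom y (p * 'X^i) = 0) -> orth y p n.
Proof.
move=> H h hn.
have -> : h = \sum_(i < n) h`_i *: 'X^i.
  rewrite -[LHS]coefK poly_def (big_ord_widen _ (fun i => h`_i *: 'X^i) hn).
  rewrite [RHS](bigID (fun i : 'I_n => (i < size h)%N))/= [X in _ + X]big1 ?addr0//.
  by move=> i; rewrite -leqNgt => /(nth_default 0) ->; rewrite scale0r.
rewrite mulr_sumr raddf_sum/= big1// => i _.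
by rewrite -scalerAr momZ H ?mulr0.
Qed.

End MomentFunctional.

(** * Nodal polynomials and Lagrange interpolation *)

Section Lagrange.
Variables (R : realType) (n : nat) (x : 'I_n -> R).
Hypothesis x_inj : injective x.
Implicit Types f h : {poly R}.

Definition nodal : {poly R} := \prod_i ('X - (x i)%:P).

Lemma size_nodal : size nodal = n.+1.
Proof. by rewrite size_prod_XsubC -[RHS]/(n.+1) /index_enum -enumT size_enum_ord. Qed.

Lemma monic_nodal : nodal \is monic.
Proof. exact: monic_prod_XsubC. Qed.

Lemma nodal_root i : nodal.[x i] = 0.
Proof. by rewrite horner_prod (bigD1 i)//= !hornerE subrr mul0r. Qed.

Lemma nodalP f : (forall i, f.[x i] = 0) -> exists h, f = h * nodal.
Proof.
move=> f0.
have := @uniq_roots_prod_XsubC _ f (codom x).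
rewrite uniq_rootsE => -[||h fE].
- by apply/allP => _ /codomP[i ->]; rewrite /root f0.
- by rewrite /codom map_inj_uniq// enum_uniq.
- by exists h; rewrite {1}fE big_map /nodal big_enum.
Qed.

Lemma root_nodalP a : root nodal a -> exists i, a = x i.
Proof.
rewrite /root horner_prod prodf_seq_eq0 => /hasP[i _ /=].
by rewrite !hornerE subr_eq0 => /eqP ->; exists i.
Qed.

Lemma eq0_nodal f : (size f <= n)%N -> (forall i, f.[x i] = 0) -> f = 0.
Proof.
move=> fn /nodalP[h fE]; apply/eqP/negPn/negP => f0.
have h0 : h != 0 by apply: contraNneq f0 => h0; rewrite fE h0 mul0r.
move: fn; rewrite fE size_Mmonic// ?monic_nodal// size_nodal addnS/=.
by rewrite leqNgt -addn1 addnC leq_add2r lt0n size_poly_eq0 h0.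
Qed.

Definition lagr i : {poly R} :=
  let q := \prod_(j | j != i) ('X - (x j)%:P) in q.[x i]^-1 *: q.

Lemma size_lagr i : (size (lagr i) <= n)%N.
Proof.
apply: leq_trans (size_scale_leq _ _) _.
rewrite -big_filter size_prod_XsubC size_filter.
have := count_predC (pred1 i) (index_enum 'I_n).
rewrite [X in _ = X](_ : _ = n); last by rewrite /index_enum -enumT size_enum_ord.
rewrite (@count_uniq_mem _ _ i) ?index_enum_uniq// mem_index_enum => E.
by rewrite add1n in E; rewrite [X in (X <= _)%N]E.
Qed.

Lemma horner_lagr i j : (lagr i).[x j] = (j == i)%:R.
Proof.
rewrite hornerZ; have [->|ji] := eqVneq j i; last first.
  by rewrite [X in _ * X](_ : _ = 0) ?mulr0// horner_prod (bigD1 j)//= hornerXsubC subrr mul0r.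
rewrite mulVf// horner_prod; apply/prodf_neq0 => k ki.
by rewrite hornerXsubC subr_eq0 (inj_eq x_inj) eq_sym.
Qed.

End Lagrange.

(** * Gauss quadrature: uniqueness and existence *)

(** The second family is left arbitrary so that it can come from any cp-decomposition, where vectors
    may vanish or be proportional. *)
Lemma atoms_perm (R : realType) (r : nat) (x x' w w' : 'I_r -> R) :
  injective x -> (forall i, 0 < w i) ->
  (forall k, (k < r + r)%N -> \sum_i w i * x i ^+ k = \sum_i w' i * x' i ^+ k) ->
  exists t : {perm 'I_r}, forall i, x' i = x (t i) /\ w' i = w (t i).
Proof.
move=> x_inj w0 eqmom.
pose y k := \sum_i w i * x i ^+ k.
have yx (f : {poly R}) : (size f <= r + r)%N -> mom y f = \sum_i w i * f.[x i].
  exact: mom_quadrature.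
have yx' (f : {poly R}) : (size f <= r + r)%N -> mom y f = \sum_i w' i * f.[x' i].
  by apply: mom_quadrature => k kr; rewrite -eqmom.
(* Both nodal polynomials are monic of degree [r] and orthogonal to lower degrees. *)
have eqN : nodal x' = nodal x.
  pose h := nodal x' - nodal x.
  have hr : (size h <= r)%N.
    have [->|h0] := eqVneq h 0; first by rewrite size_poly0.
    rewrite -ltnS; have : (size h <= r.+1)%N.
      by apply: leq_trans (size_polyD _ _) _; rewrite size_polyN !size_nodal maxnn.
    rewrite leq_eqVlt => /orP[/eqP hE|//].
    have : lead_coef h = 0.
      rewrite lead_coefE hE /= coefB.
      have := monic_nodal x'; have := monic_nodal x.
      by rewrite !monicE !lead_coefE !size_nodal/= => /eqP -> /eqP ->; rewrite subrr.
    by move=> /eqP; rewrite lead_coef_eq0 (negbTE h0).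
  have sz (z : 'I_r -> R) : (size (nodal z * h)%R <= r + r)%N.
    apply: leq_trans (size_polyMleq _ _) _; rewrite size_nodal addSn.
    exact: leq_add.
  have szh : (size (h * h)%R <= r + r)%N.
    apply: leq_trans (size_polyMleq _ _) _.
    by apply: leq_trans (leq_pred _) _; rewrite leq_add.
  (* Each quadrature annihilates the multiples of its own nodal polynomial, so the two halves of
     [h * h] are evaluated with different quadratures. *)
  have : mom y (h * h) = 0.
    rewrite {1}/h mulrBl momB yx'// yx// !big1 ?subrr// => i _;
    by rewrite hornerM nodal_root mul0r mulr0.
  rewrite yx// => /eqP; rewrite psumr_eq0; last first.
    by move=> i _; rewrite mulr_ge0 ?(ltW (w0 _))// hornerM -expr2 sqr_ge0.
  move=> /allP H; apply/eqP; rewrite -subr_eq0; apply/eqP.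
  apply: (eq0_nodal x_inj hr) => i.
  have /= := H i (mem_index_enum _).
  by rewrite mulf_eq0 (gt_eqF (w0 i))/= hornerM mulf_eq0 orbb => /eqP.
have ex i : exists j, x i = x' j.
  by apply: root_nodalP; rewrite eqN /root nodal_root.
have [t tE] := choice ex.
have t_inj : injective t by move=> i j tij; apply: x_inj; rewrite !tE tij.
exists (perm t_inj)^-1%g => i.
have -> : i = t ((perm t_inj)^-1%g i) by rewrite -[LHS](permKV (perm t_inj)) permE.
set j := _ i; rewrite -[t j in X in w X](permE t_inj) permK -tE; split.
  by rewrite -[t j](permE t_inj) permK.
(* Evaluated on [lagr x j], each quadrature retains a single weight. *)
have sl : (size (lagr x j) <= r + r)%N by rewrite (leq_trans (size_lagr _ _))// leq_addr.
have := yx _ sl; rewrite yx'// (reindex_inj t_inj)/=.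
under eq_bigr do rewrite -tE horner_lagr//.
under [X in _ = X -> _]eq_bigr do rewrite horner_lagr//.
rewrite (bigD1 j)//= eqxx mulr1 big1 ?addr0; last by move=> k /negbTE ->; rewrite mulr0.
rewrite (bigD1 j)//= eqxx mulr1 big1 ?addr0//; by move=> k /negbTE ->; rewrite mulr0.
Qed.

(** If [p] were [h] times a sum of two squares, [p * h] would have positive moment, against
    orthogonality; hence [p] splits with simple roots. Division by [p] makes interpolation at these
    roots exact below degree [r + m]. As [lagr x i] and its square agree at the roots, each weight
    is the moment of a square. *)
Lemma gauss_quadrature (R : realType) (y : nat -> R) (r m : nat) (p : {poly R}) :
  p \is monic -> size p = r.+1 -> posdef y r -> orth y p m -> (r <= m)%N ->
  exists x w : 'I_r -> R, [/\ injective x, forall i, 0 < w i, p = nodal x &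
    forall k, (k < r + m)%N -> y k = \sum_i w i * x i ^+ k].
Proof.
move=> pmon sp pd po rm.
have [|rs [urs prs]] := no_square_factor_splits pmon.
  move=> a b h pE.
  have q2 : size (('X - a%:P) ^+ 2 + (b ^+ 2)%:P) = 3%N.
    rewrite size_polyDl ?size_exp_XsubC// size_polyC; by case: (_ != 0).
  have q0 : ('X - a%:P) ^+ 2 + (b ^+ 2)%:P != 0 :> {poly R}.
    by rewrite -size_poly_eq0 q2.
  have h0 : h != 0.
    by apply: contra_eqN sp => /eqP h0; rewrite pE h0 mul0r size_poly0.
  have hr : (size h).+1 = r.
    by move: sp; rewrite pE size_mul// q2 addnS/= addn2 => -[].
  have : mom y (p * h) = 0 by apply: po; rewrite (leq_trans _ rm)// -hr.
  have -> : p * h = (h * ('X - a%:P)) ^+ 2 + b ^+ 2 *: h ^+ 2.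
    by rewrite pE -mul_polyC; ring.
  rewrite momD momZ => /eqP; apply/negP; rewrite gt_eqF//.
  rewrite ltr_wpDr//; first by rewrite mulr_ge0 ?sqr_ge0// ltW// pd// -hr.
  apply: pd; first by rewrite mulf_neq0// polyXsubC_eq0.
  by rewrite size_Mmonic ?monicXsubC// size_XsubC addn2/= hr.
have srs : size rs = r by move: sp; rewrite prs size_prod_XsubC => -[].
pose x (i : 'I_r) := rs`_i.
have x_inj : injective x.
  move=> i j; rewrite /x => /eqP; rewrite nth_uniq ?srs// => /eqP/val_inj//.
have pN : p = nodal x.
  by rewrite prs (big_nth 0) srs big_mkord.
have exact_ (f : {poly R}) : (size f <= r + m)%N -> mom y f = \sum_i mom y (lagr x i) * f.[x i].
  move=> fs; pose g := \sum_i f.[x i] *: lagr x i.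
  have gr : (size g <= r)%N.
    apply: (leq_trans (size_sum _ _ _)); apply/bigmax_leqP => i _.
    by rewrite (leq_trans (size_scale_leq _ _))// size_lagr.
  have [i|h fg] := @nodalP _ _ x x_inj (f - g).
    rewrite hornerD hornerN horner_sum (bigD1 i)//= hornerZ horner_lagr// eqxx mulr1.
    rewrite big1 ?addr0 ?subrr// => j ji.
    by rewrite hornerZ horner_lagr// eq_sym (negbTE ji) mulr0.
  have hm : (size h <= m)%N.
    have [->|h0] := eqVneq h 0; first by rewrite size_poly0.
    have : (size (h * nodal x)%R <= r + m)%N.
      rewrite -fg (leq_trans (size_polyD _ _))// geq_max fs size_polyN.
      by rewrite (leq_trans gr)// leq_addr.
    by rewrite size_Mmonic ?monic_nodal// size_nodal addnS/= addnC leq_add2l.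
  have : mom y (f - g) = 0 by rewrite fg mulrC -pN po.
  rewrite momB => /eqP; rewrite subr_eq0 => /eqP ->.
  by rewrite raddf_sum/=; apply: eq_bigr => i _; rewrite momZ mulrC.
exists x, (fun i => mom y (lagr x i)); split => // [i|k km].
- have -> : mom y (lagr x i) = mom y (lagr x i ^+ 2).
    rewrite [RHS]exact_; last first.
      have /leq_trans : (size (lagr x i ^+ 2)%R <= r + r)%N; last by apply; rewrite leq_add2l.
      apply: leq_trans (size_polyMleq _ _) _; apply: leq_trans (leq_pred _) _.
      by rewrite leq_add// size_lagr.
    rewrite (bigD1 i)//= horner_exp horner_lagr// eqxx expr1n mulr1 big1 ?addr0// => j ji.
    by rewrite horner_exp horner_lagr// (negbTE ji) expr0n mulr0.
  apply: pd; last exact: size_lagr.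
  apply/eqP => l0; have := horner_lagr x_inj i i.
  by rewrite l0 horner0 eqxx => /esym/eqP; rewrite oner_eq0.
- rewrite -[LHS]momXn exact_ ?size_polyXn//.
  by apply: eq_bigr => i _; rewrite hornerXn.
Qed.

(** * Hankel matrices: quadratic form, inverse, rank *)

Section Hankel.
Variable R : realType.
Implicit Types (y z : nat -> R) (p q f g h : {poly R}).

Definition hankel z n : 'M[R]_n := \matrix_(i, j) z (i + j)%N.

Lemma mom_mul z n m f g : (size f <= n)%N -> (size g <= m)%N ->
  mom z (f * g) = \sum_(i < n) \sum_(j < m) f`_i * z (i + j)%N * g`_j.
Proof.
have wide k (h : {poly R}) : (size h <= k)%N -> h = \sum_(i < k) h`_i *: 'X^i.
  by move=> hk; rewrite -poly_def; apply/polyP => i; rewrite coef_poly;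
    case: ltnP => // ki; rewrite nth_default// (leq_trans hk).
move=> /wide {1}-> /wide {1}->; rewrite mulr_suml raddf_sum/=.
apply: eq_bigr => i _; rewrite mulr_sumr raddf_sum/=; apply: eq_bigr => j _.
rewrite -scalerAl -scalerAr !momZ -exprD momXn. ring.
Qed.

Lemma hankel_form z n (u v : 'rV[R]_n) :
  (u *m hankel z n *m v^T) 0 0 = mom z (rVpoly u * rVpoly v).
Proof.
rewrite (@mom_mul _ n n) ?size_poly// exchange_big/= !mxE; apply: eq_bigr => j _.
rewrite !mxE mulr_suml; apply: eq_bigr => i _.
by rewrite !mxE !coef_rVpoly_ord.
Qed.

Lemma mom_mulX y f : mom y ('X * f) = mom (fun k => y k.+1) f.
Proof.
rewrite (@mom_widen _ y _ (size f).+1).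
  rewrite big_ord_recl/= coefXM eqxx mul0r add0r.
  by apply: eq_bigr => i _; rewrite coefXM.
by rewrite mulrC (leq_trans (size_polyMleq _ _))// size_polyX addn2.
Qed.

Lemma mom_mul1X y f : mom y ((1 - 'X) * f) = mom (fun k => y k - y k.+1) f.
Proof.
rewrite mulrBl mul1r momB mom_mulX -sumrB; apply: eq_bigr => i _.
by rewrite mulrBr.
Qed.

Lemma psd_hankel z n f : psd (hankel z n) -> (size f <= n)%N -> 0 <= mom z (f ^+ 2).
Proof.
move=> [_ H] fn; have := H (poly_rV f : 'rV_n)^T.
by rewrite trmxK hankel_form poly_rV_K.
Qed.

Lemma posdef_hankel_unit z n : posdef z n -> hankel z n \in unitmx.
Proof.
move=> pd; rewrite -row_free_unit; apply: inj_row_free => v v0.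
have := hankel_form z v v; rewrite v0 mul0mx mxE => /esym/eqP.
apply: contraTeq => vn0; rewrite gt_eqF// -expr2; apply: pd; last exact: size_poly.
by apply: contraNneq vn0 => e; rewrite -[v]rVpolyK e raddf0.
Qed.

Lemma pinv_unit n (M : 'M[R]_n) : M \in unitmx -> Defs.pinv M = invmx M.
Proof.
move=> Mu.
have [] : penrose M (Defs.pinv M).
  apply: xgetPex; exists (invmx M).
  by split; rewrite ?(mulmxV Mu) ?(mulVmx Mu) ?mul1mx ?trmx1.
move=> E _ _ _; have := congr1 (fun X => invmx M *m X *m invmx M) E.
by rewrite !mulmxA mulVmx// !mul1mx -!mulmxA mulmxV// mulmx1.
Qed.

(** [q] is ['X^n] minus its orthogonal projection on the lower degrees, whose coefficients solve the
    normal equations. The last moment equals [mom z (q ^+ 2)], a Schur complement in the Hankel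
    matrix of size [n.+1]; the weights ['X] and [1 - 'X] will turn it into the formulas for [l] and
    [u]. *)
Lemma orth_poly z n : posdef z n ->
  let b := \col_(i < n) z (n + i)%N in
  exists q, [/\ q \is monic, size q = n.+1, orth z q n &
    mom z (q * 'X^n) = z (2 * n)%N - (b^T *m Defs.pinv (hankel z n) *m b) 0 0].
Proof.
move=> pd b; have Mu := posdef_hankel_unit pd.
pose c := b^T *m invmx (hankel z n).
have Mt : (hankel z n)^T = hankel z n by apply/matrixP => i j; rewrite !mxE addnC.
have cM : c *m hankel z n = b^T by rewrite /c -mulmxA mulVmx// mulmx1.
have cn : (size (rVpoly c) < size ('X^n : {poly R}))%N by rewrite size_polyXn ltnS size_poly.
have cX k : mom z (rVpoly c * 'X^k) = \sum_(i < n) c 0 i * z (i + k)%N.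
  rewrite (@mom_mul _ n k.+1) ?size_poly ?size_polyXn//; apply: eq_bigr => i _.
  rewrite big_ord_recr/= coefXn eqxx mulr1 coef_rVpoly_ord big1 ?add0r// => j _.
  by rewrite coefXn ltn_eqF ?mulr0.
exists ('X^n - rVpoly c); split.
- by rewrite monicE lead_coefDl ?size_polyN// lead_coefXn.
- by rewrite size_polyDl ?size_polyN// size_polyXn.
- apply: orthP => i ni; rewrite mulrBl momB -exprD momXn cX.
  have := congr1 (fun X : 'rV_n => X 0 (Ordinal ni)) cM; rewrite !mxE/= => <-.
  by apply/eqP; rewrite subr_eq0; apply/eqP/eq_bigr => j _; rewrite !mxE.
- rewrite mulrBl momB -exprD momXn cX addnn mul2n pinv_unit//; congr (_ - _).
  by rewrite -/c mxE; apply: eq_bigr => j _; rewrite !mxE addnC.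
Qed.

(** The first [r] rows are independent: a vanishing combination of them is a polynomial of degree
    below [r] orthogonal to itself. *)
Lemma rank_hankel_ge y n r : (r <= n)%N -> posdef y r -> (r <= \rank (hankel y n))%N.
Proof.
move=> rn pd; pose A := rowsub (widen_ord rn) (hankel y n).
have : row_free A.
  apply: inj_row_free => v v0.
  have o : orth y (rVpoly v) n.
    apply: orthP => k kn; have := congr1 (fun X : 'rV_n => X 0 (Ordinal kn)) v0.
    rewrite !mxE => <-; rewrite (@mom_mul _ r k.+1) ?size_poly ?size_polyXn//.
    apply: eq_bigr => i _; rewrite !mxE/=.
    rewrite big_ord_recr/= coefXn eqxx mulr1 coef_rVpoly_ord big1 ?add0r// => j _.
    by rewrite coefXn ltn_eqF ?mulr0.
  have [vE|vn0] := eqVneq (rVpoly v) 0; first by rewrite -[v]rVpolyK vE raddf0.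
  have := pd _ vn0 (size_poly _ _); rewrite expr2 o ?ltxx//.
  by rewrite (leq_trans (size_poly _ _)).
rewrite /row_free => /eqP <-; rewrite mxrankS//; apply/row_subP => i.
by rewrite row_rowsub row_sub.
Qed.

(** The matrix factors through dimension [n], in Vandermonde fashion. The homogeneous form in [a]
    and [b] applies to a cp-decomposition without dividing by the sum of the entries of a vector. *)
Lemma rank_hankel_le y s n (w a b : 'I_n -> R) :
  (forall k, (k <= 2 * s)%N -> y k = \sum_i w i * a i ^+ (2 * s - k) * b i ^+ k) ->
  (\rank (hankel y s.+1) <= n)%N.
Proof.
move=> yE.
have -> : hankel y s.+1 = (\matrix_(j < s.+1, i < n) (w i * a i ^+ (s - j) * b i ^+ j)) *m
   (\matrix_(i < n, j < s.+1) (a i ^+ (s - j) * b i ^+ j)).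
  apply/matrixP => i j; rewrite !mxE.
  have hi : (i <= s)%N by rewrite -ltnS.
  have hj : (j <= s)%N by rewrite -ltnS.
  rewrite yE; last by rewrite mul2n -addnn leq_add.
  apply: eq_bigr => k _; rewrite !mxE.
  have -> : (2 * s - (i + j) = (s - i) + (s - j))%N by lia.
  by rewrite !exprD; ring.
exact: mulmx_max_rank.
Qed.

End Hankel.

(** * The kernel of the Hankel form under both positivity conditions *)

Section TruncatedHausdorff.
Variables (R : realType) (s : nat) (y : nat -> R).
Hypotheses (psd1 : psd (H1 s y)) (psd2 : psd (H2 s y)).
Implicit Types (p q f g h : {poly R}).

Lemma nonneg_sqr f : (size f <= s.+1)%N -> 0 <= mom y (f ^+ 2).
Proof. exact: psd_hankel psd1. Qed.

(** [H2] is the Hankel matrix of the sequence reweighted by ['X * (1 - 'X)]. *)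
Lemma nonneg_X1X f : (size f <= s)%N -> 0 <= mom y ('X * (1 - 'X) * f ^+ 2).
Proof.
move=> fs; rewrite -mulrA mom_mulX mom_mul1X; apply: psd_hankel fs.
suff -> : hankel (fun k => y k.+1 - y k.+2) s = H2 s y by [].
by apply/matrixP => i j; rewrite !mxE addn1 addn2.
Qed.

(** Cauchy-Schwarz for a semidefinite form: along [h + t *: p] the form is affine in [t] and
    nonnegative, so its slope is zero. *)
Let kernel_orth p : (size p <= s.+1)%N -> mom y (p ^+ 2) = 0 -> orth y p s.+1.
Proof.
move=> ps p0 h hs.
set b := mom y (p * h); apply/eqP/negPn/negP => b0.
have E t : mom y ((h + t *: p) ^+ 2) = mom y (h ^+ 2) + 2 * t * b.
  have -> : (h + t *: p) ^+ 2 = h ^+ 2 + (2 * t) *: (p * h) + t ^+ 2 *: p ^+ 2.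
    by rewrite -!mul_polyC !polyCM; ring.
  by rewrite !momD !momZ p0 mulr0 addr0.
(* With this [t] the affine function takes the value [-1]. *)
pose t := - (mom y (h ^+ 2) + 1) / (2 * b).
have : 0 <= mom y ((h + t *: p) ^+ 2).
  apply: nonneg_sqr; rewrite (leq_trans (size_polyD _ _))// geq_max hs.
  exact: leq_trans (size_scale_leq _ _) ps.
rewrite E; have -> : 2 * t * b = - (mom y (h ^+ 2) + 1).
  by rewrite /t; field.
by rewrite opprD addrA subrr add0r oppr_ge0 ler10.
Qed.

(** The induction stops at the first degree where definiteness fails. An isotropic polynomial found
    there has exactly that degree, and is then normalized to be monic. *)
Let posdef_or_kernel n : (n <= s.+1)%N -> posdef y n \/
  exists r, exists2 p, (r < n)%N /\ posdef y r &
    [/\ p \is monic, size p = r.+1 & mom y (p ^+ 2) = 0].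
Proof.
elim: n => [|n IH] ns.
  by left => f /negP + f0; case; rewrite -size_poly_eq0 -leqn0.
have [pd|[r [p [rn pd] pP]]] := IH (ltnW ns); last first.
  by right; exists r, p => //; split=> //; exact: ltnW.
have [|npd] := pselect (posdef y n.+1); first by left.
right; exists n.
move/existsNP: npd => [f /not_implyP[f0 /not_implyP[fn /negP]]].
rewrite -leNgt => fle.
have fz : mom y (f ^+ 2) = 0.
  by apply/eqP; rewrite eq_le fle nonneg_sqr// (leq_trans fn).
have fs : size f = n.+1.
  apply/eqP; rewrite eqn_leq fn ltnNge; apply/negP => fn'.
  by have := pd _ f0 fn'; rewrite fz ltxx.
have lf : lead_coef f != 0 by rewrite lead_coef_eq0.
exists ((lead_coef f)^-1 *: f); first by split.
split.
- by rewrite monicE lead_coefZ mulVf.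
- by rewrite size_scale// invr_eq0.
- by rewrite exprZn momZ fz mulr0.
Qed.

(* If [q] lies in the kernel of [H1], positivity of [H2] gives [0 <= mom y (X q^2) - mom y ((X q)^2) = - mom y ((X q)^2)]. *)
Let kernel_shift p r : (size p <= r.+1)%N -> mom y (p ^+ 2) = 0 ->
  forall j, (r + j <= s)%N -> orth y ('X^j * p) s.+1.
Proof.
move=> pr p0; elim=> [|j IH] rj.
  by rewrite mul1r; apply: kernel_orth => //; rewrite (leq_trans pr)// ltnS -[r]addn0.
have szq k : (r + k <= s)%N -> (size ('X^k * p)%R <= s.+1)%N.
  move=> rk; rewrite (leq_trans (size_polyMleq _ _))// size_polyXn addSn/=.
  by rewrite (leq_trans (_ : _ <= k + r.+1)%N) ?leq_add2l// addnS ltnS addnC.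
set q := 'X^j * p in IH.
have oq : orth y q s.+1 by apply: IH; rewrite ltnW// -addnS.
have -> : 'X^(j.+1) * p = 'X * q by rewrite exprS mulrA.
have sXq : (size ('X * q)%R <= s.+1)%N by rewrite mulrA -exprS szq.
apply: kernel_orth => //; apply/eqP; rewrite eq_le nonneg_sqr// andbT.
have sq : (size q <= s)%N.
  have [->|q0] := eqVneq q 0; first by rewrite size_poly0.
  by move: sXq; rewrite mulrC size_mulX.
have := nonneg_X1X sq.
have -> : 'X * (1 - 'X) * q ^+ 2 = q * ('X * q) - ('X * q) ^+ 2 by ring.
by rewrite momB oq// sub0r oppr_ge0.
Qed.

Lemma posdef_rank_kernel : exists r, [/\ (r <= s.+1)%N, posdef y r &
  (r <= s)%N -> exists p, [/\ p \is monic, size p = r.+1 & orth y p (2 * s - r).+1]].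
Proof.
have [pd|[r [p [rs pd] [pm ps p0]]]] := posdef_or_kernel (leqnn _).
  by exists s.+1; split => //; rewrite ltnn.
exists r; split=> // [|_]; first exact: ltnW.
exists p; split => //; apply: orthP => k ks.
(* The factor ['X^j * p] has degree at most [s], so it is still in the kernel; the remaining factor
   has degree [k - j], at most [s] because [k <= 2 * s - r]. *)
pose j := minn k (s - r).
have -> : p * 'X^k = ('X^j * p) * 'X^(k - j).
  by rewrite [in RHS]mulrAC -exprD subnKC ?geq_minl// mulrC.
apply: (kernel_shift (r := r)); rewrite ?ps//.
- by rewrite /j; lia.
- by rewrite size_polyXn /j; lia.
Qed.

End TruncatedHausdorff.

Lemma orthS (R : realType) (y : nat -> R) (p : {poly R}) n :
  orth y p n -> mom y (p * 'X^n) = 0 -> orth y p n.+1.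
Proof.
move=> o on; apply: orthP => i; rewrite ltnS leq_eqVlt => /orP[/eqP ->//|ni].
by apply: o; rewrite size_polyXn.
Qed.

(** * Quadratures on the unit interval and the range of the next moment *)

Section Quadratures.
Variables (R : realType) (s : nat) (y : nat -> R).
Hypotheses (psd1 : psd (H1 s y)) (psd2 : psd (H2 s y)).
Implicit Types (p q f g h : {poly R}).

(** Tested on [f], the form of weight ['X * (1 - 'X)] reduces to the single term of index [i], which
    gives its sign. Other nodes at 0 or 1 impose nothing on [f]; this saves one degree in
    [extremal_quadrature]. *)
Lemma node_in_unit n (x w : 'I_n -> R) i f : (forall j, 0 < w j) ->
  (forall k, (k <= 2 * s)%N -> y k = \sum_j w j * x j ^+ k) ->
  (size f <= s)%N -> (forall j, j != i -> x j * (1 - x j) * f.[x j] = 0) ->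
  f.[x i] != 0 -> 0 <= x i <= 1.
Proof.
move=> w0 yE fs fj fi; have := nonneg_X1X psd2 fs.
rewrite (mom_quadrature (N := (2 * s).+1) yE); last first.
  have [->|f0] := eqVneq f 0; first by rewrite expr0n mulr0 size_poly0.
  have X0 : 'X != 0 :> {poly R} by rewrite polyX_eq0.
  have X1 : size (1 - 'X : {poly R}) = 2%N by rewrite -opprB size_polyN size_XsubC.
  rewrite (leq_trans (size_polyMleq _ _))//.
  have := size_polyMleq ('X : {poly R}) (1 - 'X); rewrite size_polyX X1/=.
  have := size_exp_leq f 2; rewrite -size_poly_gt0 in f0; move: fs f0.
  move: (size ('X * (1 - 'X))%R) (size (f ^+ 2)%R) (size f) => a b c; lia.
rewrite (bigD1 i)//= big1 ?addr0 => [|j ji]; last first.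
  have -> : ('X * (1 - 'X) * f ^+ 2).[x j] = x j * (1 - x j) * f.[x j] * f.[x j].
    by rewrite !hornerE.
  by rewrite fj// mul0r mulr0.
have -> : ('X * (1 - 'X) * f ^+ 2).[x i] = x i * (1 - x i) * f.[x i] ^+ 2.
  by rewrite !hornerE.
rewrite pmulr_rge0// pmulr_lge0 ?exprn_even_gt0//.
move=> H; apply/andP; split; nra.
Qed.

(** The degree [r] at which definiteness stops is the rank: definiteness bounds the rank from below,
    and for [r <= s] the quadrature with [r] atoms bounds it from above. *)
Lemma posdef_rank : posdef y (\rank (H1 s y)) /\
  ((\rank (H1 s y) <= s)%N -> exists x w : 'I_(\rank (H1 s y)) -> R,
    [/\ injective x, forall i, 0 < w i, forall i, 0 <= x i <= 1 &
     forall k, (k <= 2 * s)%N -> y k = \sum_i w i * x i ^+ k]).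
Proof.
have [r [rs pd ker]] := posdef_rank_kernel psd1 psd2.
have rk : (r <= \rank (H1 s y))%N := rank_hankel_ge rs pd.
move: rs; rewrite leq_eqVlt => /orP[/eqP rE|rs].
  have rkE : \rank (H1 s y) = s.+1 by apply/eqP; rewrite eqn_leq rank_leq_row; move: rk; rewrite rE.
  by rewrite rkE -{1}rE ltnn; split.
have [p [pm ps po]] := ker rs.
have [|x [w [x_inj w0 _ yE]]] := gauss_quadrature pm ps pd po.
  by move: rs; lia.
have {}yE k : (k <= 2 * s)%N -> y k = \sum_i w i * x i ^+ k.
  by move=> ks; apply: yE; move: rs; lia.
have rkE : \rank (H1 s y) = r.
  apply/eqP; rewrite eqn_leq rk andbT.
  apply: (@rank_hankel_le _ y s r w (fun=> 1) x) => k ks.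
  by rewrite yE//; apply: eq_bigr => i _; rewrite expr1n mulr1.
rewrite rkE; split=> // _; exists x, w; split => // i.
apply: (node_in_unit (f := lagr x i) w0 yE).
- by rewrite (leq_trans (size_lagr _ _)).
- by move=> j ji; rewrite horner_lagr// (negbTE ji) mulr0.
- by rewrite horner_lagr// eqxx oner_neq0.
Qed.

(** The next moment is a parameter [t]; for [t = lval s y] this is [yext s y] by conversion. *)
Definition ext_mom (t : R) k := if k == (2 * s).+1 then t else y k.

Lemma ext_mom_id t k : (k <= 2 * s)%N -> ext_mom t k = y k.
Proof. by move=> ks; rewrite /ext_mom ltn_eqF. Qed.

Hypothesis pd : posdef y s.+1.

(** The splitting ['X = 'X^2 + 'X * (1 - 'X)] gives a strictly positive square and a nonnegative
    term. For the weight [1 - 'X] the square is that of ['X - 1]. Only moments of order below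
    [2 * s] occur, so [t] does not interfere. *)
Let posdefX t : posdef (fun k => ext_mom t k.+1) s.
Proof.
move=> f f0 fs; have sf2 : (size (f ^+ 2) <= (2 * s).-1)%N.
  by have := size_exp_leq f 2; move: fs; rewrite -size_poly_gt0 in f0; move: f0; lia.
rewrite (eq_mom (y' := fun k => y k.+1) _ sf2) -?mom_mulX => [|k ks]; last first.
  by rewrite ext_mom_id//; move: ks; lia.
have -> : 'X * f ^+ 2 = ('X * f) ^+ 2 + 'X * (1 - 'X) * f ^+ 2 by ring.
rewrite momD ltr_wpDr ?(nonneg_X1X psd2)//; apply: pd; rewrite ?mulf_neq0 ?polyX_eq0//.
by rewrite mulrC size_mulX.
Qed.

Let posdef1X t : posdef (fun k => ext_mom t k - ext_mom t k.+1) s.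
Proof.
move=> f f0 fs; have sf2 : (size (f ^+ 2) <= (2 * s).-1)%N.
  by have := size_exp_leq f 2; move: fs; rewrite -size_poly_gt0 in f0; move: f0; lia.
rewrite (eq_mom (y' := fun k => y k - y k.+1) _ sf2) -?mom_mul1X => [|k ks]; last first.
  by rewrite !ext_mom_id//; move: ks; lia.
have -> : (1 - 'X) * f ^+ 2 = (('X - 1%:P) * f) ^+ 2 + 'X * (1 - 'X) * f ^+ 2 by ring.
rewrite momD ltr_wpDr ?(nonneg_X1X psd2)//; apply: pd; rewrite ?mulf_neq0 ?polyXsubC_eq0//.
by rewrite mulrC size_Mmonic ?monicXsubC// size_XsubC addn2.
Qed.

(** This is [orth_poly] for the weight ['X], whose moment of order [2 * s] is [t]. Thus [t = l] is
    exactly what makes ['X * q] orthogonal to one more degree. *)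
Lemma lower_poly t : exists q, [/\ q \is monic, size q = s.+1,
  orth (ext_mom t) ('X * q) s & mom (ext_mom t) ('X * q * 'X^s) = t - lval s y].
Proof.
have [q [qm qs qo qX]] := orth_poly (posdefX t).
exists q; split=> // [h hs|]; rewrite -mulrA mom_mulX; first exact: qo.
rewrite qX.
rewrite {1}/ext_mom eqxx; congr (_ - _).
have -> : hankel (fun k => ext_mom t k.+1) s = Mmat s y.
  apply/matrixP => i j; rewrite !mxE addn1 ext_mom_id//.
  by have := ltn_ord i; have := ltn_ord j; lia.
suff -> : \col_(i < s) ext_mom t (s + i).+1 = zvec s y by [].
apply/colP => i; rewrite !mxE addn1 ext_mom_id//.
by have := ltn_ord i; lia.
Qed.

(** For the weight [1 - 'X] the moment of order [2 * s] is [y (2 * s) - t], hence the opposite sign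
    of [t]. *)
Lemma upper_poly t : exists q, [/\ q \is monic, size q = s.+1,
  orth (ext_mom t) ((1 - 'X) * q) s &
  mom (ext_mom t) ((1 - 'X) * q * 'X^s) = uval s y - t].
Proof.
have [q [qm qs qo qX]] := orth_poly (posdef1X t).
exists q; split=> // [h hs|]; rewrite -mulrA mom_mul1X; first exact: qo.
rewrite qX.
rewrite ext_mom_id// /ext_mom eqxx /uval addrAC; congr (_ - _ - _).
have -> : hankel (fun k => ext_mom t k - ext_mom t k.+1) s = Nmat s y.
  apply/matrixP => i j; rewrite !mxE addn1 !ext_mom_id//;
  by have := ltn_ord i; have := ltn_ord j; lia.
suff -> : \col_(i < s) (ext_mom t (s + i) - ext_mom t (s + i).+1) = wvec s y by [].
apply/colP => i; rewrite !mxE addn1 !ext_mom_id//;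
by have := ltn_ord i; lia.
Qed.

(** The differences [t - l] and [u - t] are the moments of ['X * q ^+ 2] and [(1 - 'X) * q ^+ 2],
    which are nonnegative at nodes of the unit interval. *)
Lemma next_moment_bounds n (x w : 'I_n -> R) :
  (forall i, 0 <= w i) -> (forall i, 0 <= x i <= 1) ->
  (forall k, (k <= 2 * s)%N -> y k = \sum_i w i * x i ^+ k) ->
  lval s y <= \sum_i w i * x i ^+ (2 * s).+1 <= uval s y.
Proof.
move=> w0 x01 yE; set t := \sum_i _.
have ytE k : (k < (2 * s).+2)%N -> ext_mom t k = \sum_i w i * x i ^+ k.
  rewrite ltnS leq_eqVlt => /orP[/eqP ->|ks]; first by rewrite /ext_mom eqxx.
  by rewrite ext_mom_id// yE.
have diff q : q \is monic -> size q = s.+1 -> (size (q - 'X^s)%R <= s)%N.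
  move=> qm qs; apply/leq_sizeP => j; rewrite leq_eqVlt => /orP[/eqP <-|sj].
    by move: qm; rewrite monicE lead_coefE qs coefB coefXn eqxx => /eqP ->; rewrite subrr.
  by rewrite coefB coefXn gtn_eqF// subr0 nth_default// qs.
have quad (c q : {poly R}) : q \is monic -> size q = s.+1 -> (size c <= 2)%N ->
    orth (ext_mom t) (c * q) s ->
    mom (ext_mom t) (c * q * 'X^s) = \sum_i w i * (c.[x i] * q.[x i] ^+ 2).
  move=> qm qs c2 qo.
  (* Since [q] is monic of degree [s], [q - 'X^s] has lower degree and is annihilated by
     orthogonality. *)
  have -> : mom (ext_mom t) (c * q * 'X^s) = mom (ext_mom t) (c * q * q).
    apply/eqP; rewrite eq_sym -subr_eq0 -momB -mulrBr; apply/eqP.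
    by apply: qo; exact: diff.
  rewrite (mom_quadrature ytE); first by apply: eq_bigr => i _; rewrite !hornerM expr2 mulrA.
  have := size_polyMleq c q; have := size_polyMleq (c * q) q; move: c2; rewrite qs; lia.
apply/andP; split.
- have [q [qm qs qo qX]] := lower_poly t.
  rewrite -subr_ge0 -qX quad ?size_polyX//; apply: sumr_ge0 => i _.
  by rewrite mulr_ge0// hornerX mulr_ge0 ?sqr_ge0//; case/andP: (x01 i).
- have [q [qm qs qo qX]] := upper_poly t.
  rewrite -subr_ge0 -qX quad//; last by rewrite -opprB size_polyN size_XsubC.
  apply: sumr_ge0 => i _; rewrite mulr_ge0// mulr_ge0 ?sqr_ge0//.
  by rewrite hornerD hornerN hornerX -[1]/(1%:P) hornerC subr_ge0; case/andP: (x01 i).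
Qed.

(** At an extreme value of [t], the polynomial ['X * q] or [('X - 1) * q] is orthogonal to all
    degrees up to [s], so it is the nodal polynomial of a Gauss quadrature that has an endpoint [c]
    of the interval among its nodes. *)
Lemma extremal_quadrature t : t = lval s y \/ t = uval s y ->
  exists x w : 'I_s.+1 -> R,
  [/\ injective x, forall i, 0 < w i, forall i, 0 <= x i <= 1 &
   forall k, (k <= (2 * s).+1)%N -> ext_mom t k = \sum_i w i * x i ^+ k].
Proof.
move=> tE.
have [c [p [pm ps c01 pc po]]] : exists c p, [/\ p \is monic, size p = s.+2,
    c * (1 - c) = 0, root p c & orth (ext_mom t) p s.+1].
  case: tE => tE.
  - have [q [qm qs qo qX]] := lower_poly t.
    exists 0, ('X * q); split; rewrite ?mul0r//.
    + by rewrite monicMl// monicX.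
    + by rewrite mulrC size_mulX ?qs// -size_poly_gt0 qs.
    + by rewrite /root hornerM hornerX mul0r.
    + by apply: orthS => //; rewrite qX tE subrr.
  - have [q [qm qs qo qX]] := upper_poly t.
    have E : ('X - 1%:P) * q = - ((1 - 'X) * q) by ring.
    exists 1, (('X - 1%:P) * q); split; rewrite ?subrr ?mulr0//.
    + by rewrite monicMl// monicXsubC.
    + by rewrite mulrC size_Mmonic ?monicXsubC ?size_XsubC ?qs ?addn2// -size_poly_gt0 qs.
    + by rewrite /root hornerM hornerXsubC subrr mul0r.
    + apply: orthS => [h hs|]; rewrite E mulNr raddfN/=; first by rewrite qo ?oppr0.
      by rewrite qX tE subrr oppr0.
have pdt : posdef (ext_mom t) s.+1.
  move=> f f0 fs; have sf2 : (size (f ^+ 2) <= (2 * s).+1)%N.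
    by have := size_exp_leq f 2; move: fs; rewrite -size_poly_gt0 in f0; move: f0; lia.
  by rewrite (eq_mom (y' := y) _ sf2) ?pd// => k ks; rewrite ext_mom_id.
have [x [w [x_inj w0 pN tE']]] := gauss_quadrature pm ps pdt po (leqnn _).
have {}tE' k : (k <= (2 * s).+1)%N -> ext_mom t k = \sum_i w i * x i ^+ k.
  by move=> ks; apply: tE'; move: ks; lia.
have yE k : (k <= 2 * s)%N -> y k = \sum_i w i * x i ^+ k.
  by move=> ks; rewrite -(ext_mom_id t ks) tE'// ltnW.
exists x, w; split => // i.
have [j0 cE] : exists j, c = x j by apply: root_nodalP; rewrite -pN.
have [->|ij] := eqVneq i j0.
  by move/eqP: c01; rewrite cE mulf_eq0 subr_eq0 => /orP[/eqP ->|/eqP <-]; rewrite lexx ler01.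
(* [lagr x i] may have size [s.+1], one too many for [H2]. Its linear factor at the endpoint node
   can be removed because the weight ['X * (1 - 'X)] vanishes there. *)
have /factor_theorem[f fE] : root (lagr x i) (x j0).
  by rewrite /root horner_lagr// [j0 == i]eq_sym (negbTE ij) eqxx.
apply: (node_in_unit (f := f) w0 yE).
- have [->|f0] := eqVneq f 0; first by rewrite size_poly0.
  have := size_lagr x i; rewrite fE size_Mmonic ?monicXsubC// size_XsubC addn2/=.
  by rewrite ltnS.
- move=> j ji; have [->|jj] := eqVneq j j0; first by rewrite -cE c01 mul0r.
  have /eqP := horner_lagr x_inj i j; rewrite fE (negbTE ji) hornerM hornerXsubC.
  by rewrite mulf_eq0 subr_eq0 (inj_eq x_inj) (negbTE jj) orbF => /eqP ->; rewrite mulr0.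
- apply/eqP => f0; have := horner_lagr x_inj i i.
  by rewrite fE hornerM f0 mul0r eqxx => /esym/eqP; rewrite oner_eq0.
Qed.

End Quadratures.

(** * Symmetric tensors in dimension two and the change of basis *)

Section Tensors.
Variables (R : comNzRingType) (d : nat).
Implicit Types (X Y : tensor R d) (S T : 'M[R]_2) (v : 'cV[R]_2).

Lemma LT_tpow T v : LT T (tpow d v) = tpow d (T *m v).
Proof.
apply/ffunP => i; rewrite !ffunE.
under [RHS]eq_bigr do rewrite mxE.
rewrite bigA_distr_bigA/=; apply: eq_bigr => j _.
by rewrite ffunE big_split.
Qed.

Lemma LT_sum T n (F : 'I_n -> tensor R d) :
  LT T (\sum_i F i) = \sum_i LT T (F i).
Proof.
apply/ffunP => i; rewrite ffunE sum_ffunE.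
under eq_bigr do rewrite sum_ffunE mulr_sumr.
by rewrite exchange_big/=; apply: eq_bigr => k _; rewrite ffunE.
Qed.

Lemma LT_comp S T X : LT S (LT T X) = LT (S *m T) X.
Proof.
apply/ffunP => i; rewrite !ffunE.
under eq_bigr do rewrite ffunE mulr_sumr.
rewrite exchange_big/=; apply: eq_bigr => l _.
under [in RHS]eq_bigr do rewrite mxE.
rewrite bigA_distr_bigA/= mulr_suml; apply: eq_bigr => j _.
by rewrite mulrA big_split.
Qed.

Lemma LT_1 X : LT 1%:M X = X.
Proof.
apply/ffunP => i; rewrite ffunE (bigD1 i)//= big1 => [|k _]; last by rewrite mxE eqxx.
rewrite mul1r big1 ?addr0// => j ji.
have [k jk] : exists k, i k != j k.
  apply/existsP; apply: contraNT ji; rewrite negb_exists => /forallP H.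
  by apply/eqP/ffunP => k; have /negPn/eqP -> := H k.
by rewrite (bigD1 k)//= mxE (negbTE jk) !mul0r.
Qed.

Lemma LT_inj S T : S *m T = 1%:M -> injective (LT (d := d) T).
Proof. by move=> ST X Y /(congr1 (LT S)); rewrite !LT_comp ST !LT_1. Qed.

Lemma LT_symmetric T X : symmetric_tensor X -> symmetric_tensor (LT T X).
Proof.
move=> sX s i; rewrite !ffunE.
pose h (j : {ffun 'I_d -> 'I_2}) := [ffun k => j (s k)].
pose h' (j : {ffun 'I_d -> 'I_2}) := [ffun k => j (s^-1%g k)].
rewrite (reindex h); last first.
  by exists h' => j _; apply/ffunP => k; rewrite !ffunE ?permK ?permKV.
apply: eq_bigr => j _; rewrite sX; congr (_ * _).
by rewrite [RHS](reindex_inj (@perm_inj _ s))/=; apply: eq_bigr => k _; rewrite !ffunE.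
Qed.

Lemma tpow_symmetric v : symmetric_tensor (tpow d v).
Proof.
move=> s i; rewrite !ffunE [RHS](reindex_inj (@perm_inj _ s))/=.
by apply: eq_bigr => k _; rewrite ffunE.
Qed.

Lemma sum_symmetric n (F : 'I_n -> tensor R d) :
  (forall i, symmetric_tensor (F i)) -> symmetric_tensor (\sum_i F i).
Proof. by move=> sF s i; rewrite !sum_ffunE; apply: eq_bigr => k _; apply: sF. Qed.

Lemma count_lt_ord k : (k <= d)%N -> count (fun m : 'I_d => (m < k)%N) (enum 'I_d) = k.
Proof.
move=> kd.
transitivity (count (fun m => (m < k)%N) (iota 0 d)); first by rewrite -val_enum_ord count_map.
rewrite -(subnKC kd) iotaD count_cat add0n (@eq_in_count _ _ predT) => [|m]; last first.
  by rewrite mem_iota.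
rewrite count_predT size_iota (@eq_in_count _ _ pred0) ?count_pred0 ?addn0// => m.
by rewrite mem_iota => /andP[km _] /=; rewrite ltnNge km.
Qed.

Lemma Bvec_tpow v k : (k <= d)%N -> Bvec (tpow d v) k = v 0 0 ^+ (d - k) * v 1 0 ^+ k.
Proof.
move=> kd; rewrite /Bvec ffunE.
rewrite (bigID (fun m : 'I_d => (m < k)%N))/= mulrC; congr (_ * _).
- rewrite (eq_bigr (fun=> v 0 0)) => [|m /negbTE mk]; last by rewrite ffunE mk.
  rewrite big_const_seq iter_mulr_1 -[index_enum _]enumT; congr (_ ^+ _).
  have := count_predC (fun m : 'I_d => (m < k)%N) (enum 'I_d).
  rewrite size_enum_ord count_lt_ord// => E.
  by apply: (@addnI k); rewrite subnKC.
- rewrite (eq_bigr (fun=> v 1 0)) => [|m mk]; last first.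
    by rewrite ffunE mk; congr (v _ _); apply/val_inj.
  by rewrite big_const_seq iter_mulr_1 -[index_enum _]enumT count_lt_ord.
Qed.

(** With only two index values, the number of entries [ord_max] determines a multi-index up to
    permutation. *)
Lemma symmetric_idx (i : {ffun 'I_d -> 'I_2}) :
  exists2 k, (k <= d)%N & exists s : {perm 'I_d}, i = [ffun m => idx d k (s m)].
Proof.
pose t := [tuple i m | m < d].
pose k := count_mem ord_max t.
have kd : (k <= d)%N by rewrite -[X in (_ <= X)%N](size_tuple t) count_size.
exists k => //; pose t' := [tuple idx d k m | m < d].
have k' : count_mem ord_max t' = k.
  rewrite /= count_map -[RHS](count_lt_ord kd); apply: eq_count => m /=.
  by rewrite ffunE; case: (m < k)%N.
have c0 (u : d.-tuple 'I_2) : count_mem ord0 u = (d - count_mem ord_max u)%N.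
  have := count_predC (pred1 ord_max) u; rewrite size_tuple => {2}<-.
  by rewrite addKn; apply: eq_count => -[[|[|]]].
have /tuple_permP[s ts] : perm_eq t t'.
  apply/allP => x _ /=; apply/eqP.
  case: (unliftP ord_max x) => [z ->|->]; last exact: esym k'.
  have -> : lift ord_max z = ord0 by apply/val_inj; case: z => -[].
  exact: (etrans (c0 t) (esym (etrans (c0 t') (congr1 (subn d) k')))).
exists s; apply/ffunP => m; rewrite ffunE.
have := congr1 (fun u : seq 'I_2 => nth ord0 u m) ts.
rewrite -!tnth_nth /= !tnth_mktuple.
by [].
Qed.

Lemma symmetric_Bvec X Y : symmetric_tensor X -> symmetric_tensor Y ->
  (forall k, (k <= d)%N -> Bvec X k = Bvec Y k) -> X = Y.
Proof.
move=> sX sY XY; apply/ffunP => i; have [k kd [s ->]] := symmetric_idx i.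
by rewrite sX sY; exact: XY.
Qed.

Lemma Tmat_mul v : Tmat R *m v = \col_j (if j == ord0 then v 0 0 + v 1 0 else v 1 0).
Proof.
apply/colP => i; rewrite !mxE !big_ord_recl big_ord0 addr0 !mxE.
case: i => -[|[|]]//= ?; rewrite ?mul0r ?mul1r ?add0r; do ?congr (_ + _);
  by congr (v _ _); apply/val_inj.
Qed.

Lemma Tmat_linv : exists S, S *m Tmat R = 1%:M.
Proof.
exists (\matrix_(i, j) (if i == j then 1 else if (i < j)%N then -1 else 0)).
apply/matrixP => i j; rewrite !mxE !big_ord_recl big_ord0 !mxE.
case: i => -[|[|]]//= ?; case: j => -[|[|]]//= ?;
by rewrite ?mul0r ?mul1r ?mulr1 ?mulr0 ?addr0 ?add0r ?subrr.
Qed.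

End Tensors.

(** * Nonnegative vectors as weighted nodes *)

Section Atoms.
Variables (R : realType) (d : nat).
Hypothesis d0 : (0 < d)%N.
Implicit Types (v : 'cV[R]_2) (A : tensor R d) (a x : R).

(** For nonnegative [v], [Tmat] sends [v] to the multiple of [(1, node v)] by the sum of its
    entries, so [tpow d v] becomes an atom of this mass at [node v]. *)
Definition weight v : R := (v 0 0 + v 1 0) ^+ d.

(* [node 0 = 0], because [x / 0 = 0]. *)
Definition node v : R := v 1 0 / (v 0 0 + v 1 0).

Definition atom_vec a x : 'cV[R]_2 :=
  \col_(j < 2) (if j == ord0 then powR a (d%:R^-1) * (1 - x) else powR a (d%:R^-1) * x).

Lemma root_powRK a : 0 <= a -> powR a (d%:R^-1) ^+ d = a.
Proof.
by move=> a0; rewrite -powR_mulrn ?powR_ge0// -powRrM mulVf ?powRr1// pnatr_eq0 -lt0n.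
Qed.

Lemma atom_vec0 a x : atom_vec a x 0 0 = powR a (d%:R^-1) * (1 - x).
Proof. by rewrite mxE. Qed.

Lemma atom_vec1 a x : atom_vec a x 1 0 = powR a (d%:R^-1) * x.
Proof. by rewrite mxE. Qed.

Lemma weight_atom_vec a x : 0 <= a -> weight (atom_vec a x) = a.
Proof.
by move=> a0; rewrite /weight atom_vec0 atom_vec1 -mulrDr subrK mulr1 root_powRK.
Qed.

Lemma node_atom_vec a x : 0 < a -> node (atom_vec a x) = x.
Proof.
move=> a0; rewrite /node atom_vec0 atom_vec1 -mulrDr subrK mulr1.
by rewrite mulrC mulKf// gt_eqF// powR_gt0.
Qed.

Lemma atom_vecK v : 0 <= v 0 0 -> 0 <= v 1 0 -> atom_vec (weight v) (node v) = v.
Proof.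
move=> v0 v1; have vD : 0 <= v 0 0 + v 1 0 by rewrite addr_ge0.
have wE : powR (weight v) (d%:R^-1) = v 0 0 + v 1 0.
  by apply: (pexpIrn d0); rewrite ?nnegrE ?powR_ge0// root_powRK// exprn_ge0.
have E1 : (v 0 0 + v 1 0) * node v = v 1 0.
  rewrite /node mulrC; have [z|nz] := eqVneq (v 0 0 + v 1 0) 0; last by rewrite divfK.
  by rewrite z mulr0; move: z; lra.
apply/colP => j; rewrite mxE wE mulrBr mulr1 E1 addrK.
by case: j => -[|[|]]//= ?; congr (v _ _); apply/val_inj.
Qed.

Lemma node01 v : 0 <= v 0 0 -> 0 <= v 1 0 -> 0 <= node v <= 1.
Proof.
move=> v0 v1; have vD : 0 <= v 0 0 + v 1 0 by rewrite addr_ge0.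
rewrite /node divr_ge0//=; have [z|nz] := eqVneq (v 0 0 + v 1 0) 0.
  by rewrite z invr0 mulr0.
by rewrite ler_pdivrMr ?mul1r ?lerDr// lt_neqAle eq_sym nz.
Qed.

Lemma weight_ge0 v : 0 <= v 0 0 -> 0 <= v 1 0 -> 0 <= weight v.
Proof. by move=> v0 v1; rewrite exprn_ge0// addr_ge0. Qed.

Lemma weight_node v k : 0 <= v 0 0 -> 0 <= v 1 0 -> (k <= d)%N ->
  (v 0 0 + v 1 0) ^+ (d - k) * v 1 0 ^+ k = weight v * node v ^+ k.
Proof.
move=> v0 v1 kd; rewrite /weight /node.
have [z|nz] := eqVneq (v 0 0 + v 1 0) 0.
  (* This is the zero vector; both sides contain [0 ^+ d], which is zero because [0 < d]. *)
  have v10 : v 1 0 = 0 by move: z; lra.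
  rewrite z v10 !mul0r -exprD subnK//.
  by rewrite expr0n gtn_eqF// mul0r.
by rewrite -{2}(subnK kd) exprD expr_div_n -mulrA [X in _ = _ * X]mulrC divfK// expf_neq0.
Qed.

Lemma Bvec_cp A m (v : 'I_m -> 'cV[R]_2) k : A = \sum_i tpow d (v i) -> (k <= d)%N ->
  Bvec (LT (Tmat R) A) k = \sum_i (v i 0 0 + v i 1 0) ^+ (d - k) * v i 1 0 ^+ k.
Proof.
move=> -> kd; rewrite LT_sum /Bvec sum_ffunE; apply: eq_bigr => i _.
by rewrite LT_tpow -/(Bvec _ k) Bvec_tpow// Tmat_mul !mxE.
Qed.

(** [Tmat] is invertible and a symmetric tensor is determined by [Bvec], so it suffices to compare
    moments. *)
Lemma tensor_of_quadrature A m (w x : 'I_m -> R) : symmetric_tensor A ->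
  (forall i, 0 < w i) ->
  (forall k, (k <= d)%N -> Bvec (LT (Tmat R) A) k = \sum_i w i * x i ^+ k) ->
  A = \sum_i tpow d (atom_vec (w i) (x i)).
Proof.
move=> sA w0 AE; have [S ST] := Tmat_linv R.
apply: (LT_inj ST); apply: symmetric_Bvec => [||k kd].
- exact: LT_symmetric.
- by apply/LT_symmetric/sum_symmetric => i; apply: tpow_symmetric.
rewrite AE// (Bvec_cp (v := fun i => atom_vec (w i) (x i)))//.
apply: eq_bigr => i _; rewrite atom_vec0 atom_vec1 -mulrDr subrK mulr1.
by rewrite exprMn mulrA -exprD subnK// root_powRK// ltW.
Qed.

End Atoms.

(** * Integration of polynomials against representing measures *)

Section Measures.
Variable R : realType.
Implicit Types (y : nat -> R) (mu : {measure set R -> \bar R}) (p : {poly R}).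

Lemma mom_integral d y mu p : representing d y mu -> (size p <= d.+1)%N ->
  mu.-integrable setT (fun t : R => p.[t]%:E) /\
  (\int[mu]_t p.[t]%:E = (mom y p)%:E)%E.
Proof.
move=> rep pd.
have E : (fun t : R => p.[t]%:E) =
    (fun t => \sum_(i < size p) (p`_i)%:E * (t ^+ i)%:E)%E.
  by apply/funext => t; rewrite horner_coef -sumEFin; apply: eq_bigr.
have int (i : 'I_(size p)) : mu.-integrable setT (fun t : R => (t ^+ i)%:E).
  by apply: (rep _ _).1; rewrite -ltnS (leq_trans (ltn_ord i)).
have int' (i : 'I_(size p)) : mu.-integrable setT (fun t : R => (p`_i)%:E * (t ^+ i)%:E)%E.
  exact: integrableZl.
rewrite E; split; first exact: integrable_sum.
rewrite integral_sum// -sumEFin; apply: eq_bigr => i _.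
rewrite integralZl// EFinM; congr (_ * _)%E.
by apply: (rep _ _).2; rewrite -ltnS (leq_trans (ltn_ord i)).
Qed.

Lemma measurable_range n (x : 'I_n -> R) : measurable (range x).
Proof.
rewrite (_ : range x = \big[setU/set0]_(i < n) [set x i]).
  by apply: bigsetU_measurable => i _; exact: measurable_set1.
rewrite -bigcup_seq; apply/seteqP; split => [_ [i _ <-]|t [i _ ->]]; last by exists i.
by exists i => //=; rewrite mem_index_enum.
Qed.

Lemma ae_eq_range n (x : 'I_n -> R) mu (f g : R -> \bar R) :
  mu (~` range x) = 0%E -> (forall i, f (x i) = g (x i)) -> ae_eq mu setT f g.
Proof.
move=> mu0 fg; exists (~` range x); split=> //.
  by apply: measurableC; exact: measurable_range.
by apply: subsetC => _ [i _ <-] _.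
Qed.

(** The indicator of [x i] equals [lagr x i] almost everywhere, so the mass depends on the moments
    and the nodes only. *)
Lemma atom_mass d y n (x : 'I_n -> R) mu i : representing d y mu -> injective x ->
  mu (~` range x) = 0%E -> (n <= d.+1)%N -> mu [set x i] = (mom y (lagr x i))%:E.
Proof.
move=> rep x_inj mu0 nd.
have [|int <-] := mom_integral (p := lagr x i) rep.
  by rewrite (leq_trans (size_lagr _ _)).
rewrite -[LHS](_ : (\int[mu]_t (\1_[set x i] t)%:E = _)%E); last first.
  by rewrite integral_indic ?setIT//; exact: measurable_set1.
apply: ae_eq_integral => //.
- by apply/measurable_EFinP; apply: measurable_indic; exact: measurable_set1.
- exact: measurable_int int.
apply: (ae_eq_range mu0) => j; rewrite horner_lagr// indicE.
have [->|ji] := eqVneq j i; first by rewrite mem_set.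
by rewrite memNset//= => /x_inj /eqP; rewrite (negbTE ji).
Qed.

Lemma atomic_quadrature d y n (x : 'I_n -> R) mu k : representing d y mu ->
  injective x -> mu (~` range x) = 0%E -> (n <= d.+1)%N -> (k <= d)%N ->
  y k = \sum_i mom y (lagr x i) * x i ^+ k.
Proof.
move=> rep x_inj mu0 nd kd.
pose g := \sum_i x i ^+ k *: lagr x i.
have gx i : g.[x i] = x i ^+ k.
  rewrite horner_sum (bigD1 i)//= hornerZ horner_lagr// eqxx mulr1 big1 ?addr0//.
  by move=> j ji; rewrite hornerZ horner_lagr// eq_sym (negbTE ji) mulr0.
have gd : (size g <= d.+1)%N.
  rewrite (leq_trans (size_sum _ _ _))//; apply/bigmax_leqP => i _.
  by rewrite (leq_trans (size_scale_leq _ _))// (leq_trans (size_lagr _ _)).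
have [int Ig] := mom_integral rep gd; have [intk Ik] := rep _ kd.
have : (\int[mu]_t (t ^+ k)%:E = \int[mu]_t g.[t]%:E)%E.
  apply: ae_eq_integral => //; [exact: measurable_int intk|exact: measurable_int int|].
  by apply: (ae_eq_range mu0) => i; rewrite gx.
rewrite Ik Ig => -[->]; rewrite raddf_sum/=; apply: eq_bigr => i _.
by rewrite momZ mulrC.
Qed.

Lemma measure_of_atoms n (x : 'I_n -> R) mu (A : set R) : injective x ->
  mu (~` range x) = 0%E -> measurable A ->
  mu A = (\sum_(i < n | x i \in A) mu [set x i])%E.
Proof.
move=> x_inj mu0 mA.
have mr := measurable_range x.
have -> : mu A = mu (A `&` range x).
  rewrite (measureDI _ mA mr) [X in (X + _)%E](_ : _ = 0%E) ?add0e//.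
  apply: (subset_measure0 _ _ _ mu0); [exact: measurableD|exact: measurableC|].
  by move=> t [].
have -> : A `&` range x = \big[setU/set0]_(i < n | x i \in A) [set x i].
  rewrite -bigcup_seq_cond; apply/seteqP; split => [t [At [i _ xi]]|t [i /= iA ->]].
    by exists i => //=; rewrite mem_index_enum xi mem_set.
  by move/andP: iA => [_ /set_mem]; split => //; exists i.
rewrite measure_bigsetU_ord// => i j _ _ [t [/= ti tj]].
by apply: x_inj; rewrite -ti -tj.
Qed.

(** A nonnegative function of integral zero vanishes almost everywhere, and [nodal x ^+ 2] vanishes
    only at the nodes. *)
Lemma kernel_concentrated d y n (x : 'I_n -> R) mu : representing d y mu ->
  (n + n <= d)%N -> mom y (nodal x ^+ 2) = 0 -> mu (~` range x) = 0%E.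
Proof.
move=> rep nd k0; pose p := nodal x ^+ 2.
have pd : (size p <= d.+1)%N.
  by rewrite (leq_trans (size_exp_leq _ _))// size_nodal/= muln2 -addnn ltnS.
have [int I0] := mom_integral rep pd; rewrite k0 in I0.
have mp := measurable_int _ int.
have : (\int[mu]_t `|p.[t]%:E| = 0)%E.
  rewrite -[RHS]I0; apply: eq_integral => t _.
  by rewrite gee0_abs// lee_fin horner_exp sqr_ge0.
move/(ae_eq_integral_abs mu measurableT mp).1 => [N [mN N0 sub]].
apply: (subset_measure0 _ mN) => //.
  by apply: measurableC; exact: measurable_range.
move=> t xt; apply: sub => /= /(_ I) [] /eqP.
rewrite horner_exp expf_eq0/= => /root_nodalP[i ti].
by apply: xt; exists i.
Qed.

Lemma exists_atomic_measure n (x w : 'I_n -> R) : (forall i, 0 <= w i) ->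
  exists mu, (forall A : set R, mu A = (\sum_i (w i * \1_A (x i))%:E)%E) /\
   forall f : R -> \bar R, (forall t, 0 <= f t)%E -> measurable_fun setT f ->
     (\int[mu]_t f t = \sum_i (w i)%:E * f (x i))%E.
Proof.
move=> w0.
(* [msum] sums a family indexed by [nat]; indices out of range are filled with [mzero]. *)
pose m_ (k : nat) : {measure set R -> \bar R} :=
  if insub k is Some i then mscale (NngNum (w0 i)) (dirac (x i)) else mzero.
exists (msum m_ n); split=> [A|f f0 mf].
  rewrite /msum; apply: eq_bigr => i _; rewrite /m_ valK /mscale/= /dirac.
  by rewrite EFinM.
rewrite ge0_integral_measure_sum//; apply: eq_bigr => i _.
rewrite /m_ valK ge0_integral_mscale// integral_dirac//.
by rewrite diracT mul1e.
Qed.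

End Measures.

(** * The linear system for the coefficients of the nodal polynomial *)

Section LinearSystem.
Variables (R : realType) (yy : nat -> R) (r m : nat) (x w : 'I_r -> R).
Hypotheses (x_inj : injective x) (w0 : forall i, 0 < w i) (rm : (r <= m.+1)%N).
Hypothesis yyE : forall k, (k <= m + r)%N -> yy k = \sum_i w i * x i ^+ k.

Lemma coef_gpoly (g : 'rV[R]_r) (j : 'I_r) : (gpoly g)`_j = g 0 j.
Proof.
rewrite coefB coefXn ltn_eqF// subr0 coef_sum (bigD1 j)//= coefZ coefXn eqxx mulr1.
rewrite big1 ?addr0// => i ij; rewrite coefZ coefXn.
by rewrite eq_sym (inj_eq val_inj) (negbTE ij) mulr0.
Qed.

(** Equation [i] says that [gpoly g] is orthogonal to ['X^i]. Together they allow the test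
    polynomials [lagr x i], which show that [gpoly g] vanishes at every node; its leading
    coefficient is [-1]. *)
Lemma solves_sysP (g : 'rV[R]_r) : solves_sys yy m g <-> gpoly g = - nodal x.
Proof.
have momX i : (i <= m)%N -> mom yy (gpoly g * 'X^i) =
    \sum_(j < r) yy (i + j)%N * g 0 j - yy (i + r)%N.
  move=> im; rewrite mulrBl momB mulr_suml raddf_sum/= -exprD momXn addnC.
  congr (_ - _); apply: eq_bigr => j _.
  by rewrite -scalerAl momZ -exprD momXn mulrC addnC.
have yyE' k : (k < (m + r).+1)%N -> yy k = \sum_i w i * x i ^+ k by exact: yyE.
have sg : (size (gpoly g + nodal x)%R <= r)%N.
  apply/leq_sizeP => j rj; rewrite coefD coefB coefXn coef_sum big1 => [|i _]; last first.
    by rewrite coefZ coefXn gtn_eqF ?mulr0// (leq_trans (ltn_ord i)).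
  rewrite sub0r; have [->|jr] := eqVneq j r.
    by have := monic_nodal x; rewrite monicE lead_coefE size_nodal => /eqP ->; rewrite addNr.
  by rewrite oppr0 add0r nth_default// size_nodal ltn_neqAle eq_sym jr.
have sgr : (size (gpoly g) <= r.+1)%N.
  rewrite -[gpoly g](addrK (nodal x)) (leq_trans (size_polyD _ _))//.
  by rewrite geq_max size_polyN size_nodal leqnn andbT ltnW.
split=> [sol|gE i im].
- have o : orth yy (gpoly g) m.+1.
    by apply: orthP => i im; rewrite momX// sol// subrr.
  apply/eqP; rewrite -subr_eq0 opprK; apply/eqP.
  apply: (eq0_nodal x_inj sg) => i; rewrite hornerD nodal_root addr0.
  have : mom yy (gpoly g * lagr x i) = 0 by apply: o; rewrite (leq_trans (size_lagr _ _)).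
  rewrite (mom_quadrature yyE'); last first.
    rewrite (leq_trans (size_polyMleq _ _))//.
    by move: (size_lagr x i) sgr rm; move: (size (lagr x i)) (size (gpoly g)) => a b; lia.
  rewrite (bigD1 i)//= big1 => [|j ji]; last first.
    by rewrite hornerM horner_lagr// (negbTE ji) !mulr0.
  rewrite hornerM horner_lagr// eqxx mulr1 addr0 => /eqP.
  by rewrite mulf_eq0 gt_eqF//= => /eqP.
- apply/eqP; rewrite -subr_eq0 -momX// (mom_quadrature yyE'); last first.
    rewrite (leq_trans (size_polyMleq _ _))// size_polyXn.
    by move: sgr im; move: (size (gpoly g)) => b; lia.
  rewrite big1// => j _.
  by rewrite hornerM gE hornerN nodal_root oppr0 mul0r mulr0.
Qed.

Lemma solves_sys_unique : exists! g : 'rV[R]_r, solves_sys yy m g.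
Proof.
exists (\row_j - (nodal x)`_j); split=> [|g].
  apply/solves_sysP; rewrite /gpoly.
  apply/polyP => k; rewrite coefB coefXn coef_sum coefN.
  have [kr|rk] := ltnP k r.
    rewrite (bigD1 (Ordinal kr))//= coefZ coefXn eqxx mulr1 mxE big1 => [|i ik].
      by rewrite addr0 ltn_eqF// subr0.
    by rewrite coefZ coefXn eq_sym -[k]/(val (Ordinal kr)) (inj_eq val_inj) (negbTE ik) mulr0.
  rewrite big1 => [|i _]; last by rewrite coefZ coefXn gtn_eqF ?mulr0// (leq_trans (ltn_ord i)).
  have [->|nk] := eqVneq k r.
    by have := monic_nodal x; rewrite monicE lead_coefE size_nodal sub0r => /eqP ->.
  by rewrite nth_default ?subr0 ?oppr0// size_nodal ltn_neqAle eq_sym nk.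
move=> /solves_sysP gE; apply/rowP => j.
by rewrite mxE -coefN -gE coef_gpoly.
Qed.

End LinearSystem.

Lemma quadrature_weight (R : realType) (y : nat -> R) d n (x w : 'I_n -> R) i :
  injective x -> (n <= d.+1)%N ->
  (forall k, (k <= d)%N -> y k = \sum_j w j * x j ^+ k) -> w i = mom y (lagr x i).
Proof.
move=> x_inj nd yE; rewrite (mom_quadrature (N := d.+1) (x := x) (w := w))//; last first.
  by rewrite (leq_trans (size_lagr _ _)).
rewrite (bigD1 i)//= horner_lagr// eqxx mulr1 big1 ?addr0// => j ji.
by rewrite horner_lagr// (negbTE ji) mulr0.
Qed.

(** * Correspondence between atomic measures and quadratures *)

Section AtomicMeasures.
Variable R : realType.
Implicit Types (y : nat -> R) (mu : {measure set R -> \bar R}).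

Lemma same_measure_perm d y n (x1 x2 : 'I_n -> R) mu1 mu2 (t : {perm 'I_n}) :
  (n <= d.+1)%N -> injective x1 -> injective x2 ->
  representing d y mu1 -> mu1 (~` range x1) = 0%E ->
  representing d y mu2 -> mu2 (~` range x2) = 0%E ->
  (forall i, x2 i = x1 (t i) /\ mom y (lagr x2 i) = mom y (lagr x1 (t i))) ->
  same_measure mu1 mu2.
Proof.
move=> nd i1 i2 rep1 c1 rep2 c2 xt A mA.
rewrite (measure_of_atoms i1 c1 mA) (measure_of_atoms i2 c2 mA).
rewrite (reindex_inj (@perm_inj _ t))/=; apply: eq_big => [i|i _].
  by rewrite (xt i).1.
by rewrite (atom_mass _ rep1)// (atom_mass _ rep2)// (xt i).2.
Qed.

(** The last clause also reaches orders beyond [d], where order [2 * s + 1] will separate two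
    measures. The absolute value makes the integrand nonnegative and changes nothing at nodes of the
    unit interval. *)
Lemma quadrature_measure d y n (x w : 'I_n -> R) :
  injective x -> (forall i, 0 < w i) -> (forall i, 0 <= x i <= 1) ->
  (forall k, (k <= d)%N -> y k = \sum_i w i * x i ^+ k) ->
  exists mu, [/\ representing d y mu, atomic n mu, supported01 mu &
    forall k, (\int[mu]_t (`|t| ^+ k)%:E = (\sum_i w i * x i ^+ k)%:E)%E].
Proof.
move=> x_inj w0 x01 yE.
have [mu [muE muI]] := exists_atomic_measure x (fun i => ltW (w0 i)).
have mX k : measurable_fun setT (fun t : R => t ^+ k) by exact: measurable_funX.
have Iabs k : (\int[mu]_t (`|t| ^+ k)%:E = (\sum_i w i * x i ^+ k)%:E)%E.
  rewrite muI => [|t|].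
  - rewrite -sumEFin; apply: eq_bigr => i _.
    by rewrite ger0_norm//; case/andP: (x01 i).
  - by rewrite lee_fin exprn_ge0.
  - apply/measurable_EFinP; apply: measurable_funX.
    exact: normr_measurable.
have conc : mu (~` range x) = 0%E.
  rewrite muE big1// => i _; rewrite indicE memNset ?mulr0//= => H.
  by apply: H; exists i.
exists mu; split=> [k kd||//|//].
- split.
    apply/integrableP; split; first exact/measurable_EFinP.
    rewrite (eq_integral (fun t : R => (`|t| ^+ k)%:E)) => [|t _]; last first.
      by rewrite /= normrX.
    by rewrite Iabs ltry.
  rewrite yE// -Iabs; apply: ae_eq_integral => //.
  + exact/measurable_EFinP.
  + apply/measurable_EFinP; apply: measurable_funX.
    exact: normr_measurable.
  + apply: (ae_eq_range conc) => i.
    by rewrite ger0_norm//; case/andP: (x01 i).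
- exists x; split=> //; split=> // i.
  rewrite muE (bigD1 i)//= indicE mem_set// mulr1.
  rewrite (@lt_le_trans _ _ (w i)%:E) ?lte_fin// leeDl// sume_ge0// => j _.
  by rewrite lee_fin mulr_ge0// ltW.
- rewrite /supported01 muE big1// => i _; rewrite indicE memNset ?mulr0//=.
  by apply; rewrite in_itv/= x01.
Qed.

Lemma atomic_measure_quadrature d y n mu : (n <= d.+1)%N ->
  representing d y mu -> atomic n mu -> supported01 mu ->
  exists x : 'I_n -> R, [/\ injective x, mu (~` range x) = 0%E,
    forall i, 0 < mom y (lagr x i), forall i, 0 <= x i <= 1 &
    forall k, (k <= d)%N -> y k = \sum_i mom y (lagr x i) * x i ^+ k].
Proof.
move=> nd rep [x [x_inj [c pos]]] s01; exists x; split=> // [i|i|k kd].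
- by have := pos i; rewrite (atom_mass _ rep)// lte_fin.
- apply: contraPT (pos i) => nx; rewrite (_ : mu _ = 0%E) ?ltxx//.
  apply: (subset_measure0 _ _ _ s01); first exact: measurable_set1.
    by apply: measurableC; exact: measurable_itv.
  by move=> t -> /=; rewrite in_itv/=; apply/negP.
- exact: atomic_quadrature rep _ _ _ _.
Qed.

End AtomicMeasures.

(** * Correspondence between cp-decompositions and quadratures *)

Section CpDecompositions.
Variables (R : realType) (d : nat) (A : tensor R d).
Hypothesis d0 : (0 < d)%N.
Let y := Bvec (LT (Tmat R) A).

Lemma cp_dec_quadrature m (v : 'I_m -> 'cV[R]_2) k : cp_dec A v -> (k <= d)%N ->
  y k = \sum_i weight d (v i) * node (v i) ^+ k.
Proof.
move=> [v0 AE] kd; rewrite /y (Bvec_cp AE)//; apply: eq_bigr => i _.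
by case: (v0 i) => a b; rewrite weight_node.
Qed.

Lemma quadrature_cp_dec m (w x : 'I_m -> R) : symmetric_tensor A ->
  (forall i, 0 < w i) -> (forall i, 0 <= x i <= 1) ->
  (forall k, (k <= d)%N -> y k = \sum_i w i * x i ^+ k) ->
  cp_dec A (fun i => atom_vec d (w i) (x i)).
Proof.
move=> sA w0 x01 yE; split=> [i|]; last exact: tensor_of_quadrature.
case/andP: (x01 i) => a b.
by rewrite atom_vec0 atom_vec1 !mulr_ge0 ?powR_ge0// subr_ge0.
Qed.

(** By [atoms_perm] the weights and nodes of any decomposition permute the given ones, and
    [atom_vecK] recovers the vectors. For [r = s.+1] and [d = 2 * s], the order [2 * r - 1] exceeds
    [d] by one, which is where [l = u] enters. *)
Lemma cp_dec_unique_of_moments r (x w : 'I_r -> R) :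
  injective x -> (forall i, 0 < w i) ->
  (forall v, cp_dec A v -> forall k, (k < r + r)%N ->
     \sum_i w i * x i ^+ k = \sum_(i < r) weight d (v i) * node (v i) ^+ k) ->
  cp_dec_unique r A.
Proof.
move=> x_inj w0 H v v' cv cv'.
have [t tE] := atoms_perm x_inj w0 (H _ cv).
have [t' t'E] := atoms_perm x_inj w0 (H _ cv').
have vE i : v i = atom_vec d (w (t i)) (x (t i)).
  by have [<- <-] := tE i; rewrite atom_vecK//; case: (cv.1 i).
have v'E i : v' i = atom_vec d (w (t' i)) (x (t' i)).
  by have [<- <-] := t'E i; rewrite atom_vecK//; case: (cv'.1 i).
by exists (t' * t^-1)%g => i; rewrite vE v'E permM permKV.
Qed.

End CpDecompositions.

Theorem theorem3p4 (R : realType) (s : nat) (A : tensor R (2 * s)%N) :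
  (0 < s)%N ->
  symmetric_tensor A ->
  let d := (2 * s)%N in
  let y := Bvec (LT (Tmat R) A) in
  psd (H1 s y) -> psd (H2 s y) -> 0 < y 0%N ->
  let r : nat := \rank (H1 s y) in
  let l := lval s y in
  let u := uval s y in
  (* (i) *)
  ((r <= s)%N -> exists! g : 'rV[R]_r, solves_sys y (d - r)%N g) /\
  (r = s.+1 -> exists! g : 'rV[R]_r, solves_sys (yext s y) s g) /\
  (* (ii) *)
  (forall g : 'rV[R]_r,
     (if (r <= s)%N then solves_sys y (d - r)%N g
      else solves_sys (yext s y) s g) ->
     exists x : 'I_r -> R,
       [/\ injective x,
           (forall i, 0 <= x i <= 1),
           (forall i, root (gpoly g) (x i)),
           (exists! lam : 'I_r -> R, (forall i, 0 < lam i) /\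
               forall k, (k <= d)%N -> y k = \sum_(i < r) lam i * x i ^+ k)
         & forall lam : 'I_r -> R,
             (forall i, 0 < lam i) ->
             (forall k, (k <= d)%N -> y k = \sum_(i < r) lam i * x i ^+ k) ->
             let a := fun i => powR (lam i) (d%:R^-1) * (1 - x i) in
             let b := fun i => powR (lam i) (d%:R^-1) * x i in
             (forall i, 0 <= a i /\ 0 <= b i) /\
             A = \sum_(i < r) tpow d (\col_(j < 2) (if j == ord0 then a i else b i))]) /\
  (* (iii) *)
  ((r <= s)%N ->
     forall mu1 mu2 : {measure set R -> \bar R},
       representing d y mu1 -> representing d y mu2 -> same_measure mu1 mu2) /\
  (r = s.+1 ->
     ((forall mu1 mu2 : {measure set R -> \bar R},
         representing d y mu1 -> atomic r mu1 -> supported01 mu1 ->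
         representing d y mu2 -> atomic r mu2 -> supported01 mu2 ->
         same_measure mu1 mu2) <-> l = u)) /\
  (* (iv) *)
  cp_rank_is A r /\
  ((r <= s)%N -> cp_dec_unique r A) /\
  (r = s.+1 -> (cp_dec_unique r A <-> l = u)).
Proof.
move=> s0 sA d y psd1 psd2 y0 r l u.
have d0 : (0 < d)%N by rewrite muln_gt0.
have rk_min n (w a b : 'I_n -> R) :
    (forall k, (k <= d)%N -> y k = \sum_i w i * a i ^+ (d - k) * b i ^+ k) -> (r <= n)%N.
  exact: rank_hankel_le.
have rs1 : (r <= s.+1)%N := rank_leq_row _.
have [pd low] := posdef_rank psd1 psd2.
rewrite -/r in pd low.
have extl : r = s.+1 -> forall t, t = l \/ t = u -> exists x w : 'I_r -> R,
    [/\ injective x, forall i, 0 < w i, forall i, 0 <= x i <= 1 &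
     forall k, (k <= (2 * s).+1)%N -> ext_mom s y t k = \sum_i w i * x i ^+ k].
  by move=> rE t tE; move: pd; rewrite rE => pd'; exact: extremal_quadrature.
have bounds : r = s.+1 -> l = u -> forall n (x w : 'I_n -> R),
    (forall i, 0 <= w i) -> (forall i, 0 <= x i <= 1) ->
    (forall k, (k <= 2 * s)%N -> y k = \sum_i w i * x i ^+ k) ->
    \sum_i w i * x i ^+ (2 * s).+1 = l.
  move=> rE lu n x w w0 x01 yE; rewrite rE in pd.
  have := next_moment_bounds psd2 pd w0 x01 yE.
  by rewrite -/l -/u -lu => /le_anti.
clearbody r.
(* One sequence [yy] and one range [m] cover both linear systems; [m + r] is [d] when [r <= s] and
   [2 * s + 1] otherwise. *)
pose yy := if (r <= s)%N then y else yext s y.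
pose m := if (r <= s)%N then (d - r)%N else s.
have [x [w [x_inj w0 x01 [rm yyE yE]]]] : exists x w : 'I_r -> R,
    [/\ injective x, forall i, 0 < w i, forall i, 0 <= x i <= 1 &
     [/\ (r <= m.+1)%N, forall k, (k <= m + r)%N -> yy k = \sum_i w i * x i ^+ k &
     forall k, (k <= d)%N -> y k = \sum_i w i * x i ^+ k]].
  rewrite /yy /m; have [rs|sr] := leqP r s.
    have [x [w [? ? ? yE]]] := low rs; exists x, w; split=> //; split=> // [|k kd].
      by move: rs; rewrite /d; lia.
    by apply: yE; move: rs kd; rewrite /d; lia.
  have rE : r = s.+1 by apply/eqP; rewrite eqn_leq rs1.
  have [x [w [? ? ? lE]]] := extl rE l (or_introl erefl).
  exists x, w; split=> //; split=> [|k|k kd]; first by rewrite rE.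
    by move=> ks; rewrite -lE//; move: ks rE; lia.
  by rewrite -lE ?leqW// ext_mom_id.
have rd : (r <= d.+1)%N by rewrite (leq_trans rs1)// /d; move: s0; lia.
have wE lam i : (forall k, (k <= d)%N -> y k = \sum_(i < r) lam i * x i ^+ k) ->
    lam i = mom y (lagr x i).
  exact: quadrature_weight.
have sysE (g : 'rV[R]_r) : (if (r <= s)%N then solves_sys y (d - r)%N g
    else solves_sys (yext s y) s g) = solves_sys yy m g.
  by rewrite /yy /m; case: ifP.
have cpA := quadrature_cp_dec d0 sA w0 x01 yE.
split; [|split; [|split; [|split; [|split; [|split; [|split]]]]]].
- move=> rs; have := solves_sys_unique x_inj w0 rm yyE.
  by rewrite /yy /m rs.
- move=> rE; have := solves_sys_unique x_inj w0 rm yyE.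
  by rewrite /yy /m leqNgt rE ltnSn.
- move=> g; rewrite sysE => /(solves_sysP x_inj w0 rm yyE) gE.
  exists x; split=> // [i||lam lam0 lamE a b].
  + by rewrite gE /root hornerN nodal_root oppr0.
  + exists w; split=> // lam [_ lamE]; apply/funext => i.
    by rewrite (wE w)// (wE lam).
  + have [pos AE] := quadrature_cp_dec d0 sA lam0 x01 lamE; split=> // i.
    by have := pos i; rewrite atom_vec0 atom_vec1.
- move=> rs mu1 mu2 rep1 rep2.
  (* The square of the nodal polynomial has degree [2 * r], still within the known moments. *)
  have k0 : mom y (nodal x ^+ 2) = 0.
    rewrite (mom_quadrature (N := d.+1) yE); last first.
      rewrite (leq_trans (size_exp_leq _ _))// size_nodal/=.
      by move: rs; rewrite /d; lia.
    by rewrite big1// => i _; rewrite horner_exp nodal_root expr0n mulr0.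
  have rrd : (r + r <= d)%N by move: rs; rewrite /d; lia.
  have c1 := kernel_concentrated rep1 rrd k0.
  have c2 := kernel_concentrated rep2 rrd k0.
  apply: (same_measure_perm (t := 1%g) rd x_inj x_inj rep1 c1 rep2 c2) => i.
  by rewrite perm1.
- move=> rE; split=> [uniq_mu|lu mu1 mu2 rep1 at1 sup1 rep2 at2 sup2].
  (* The quadratures with next moment [l] and [u] yield two admissible measures; if these coincide,
     so do their integrals of order [2 * s + 1]. *)
  + have [xl [wl [xl_inj wl0 xl01 lE]]] := extl rE l (or_introl erefl).
    have [xu [wu [xu_inj wu0 xu01 uE]]] := extl rE u (or_intror erefl).
    have [k kd|mul [repl atl supl Il]] := quadrature_measure (d := d) (y := y) xl_inj wl0 xl01.
      by rewrite -lE ?leqW// ext_mom_id.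
    have [k kd|muu [repu atu supu Iu]] := quadrature_measure (d := d) (y := y) xu_inj wu0 xu01.
      by rewrite -uE ?leqW// ext_mom_id.
    have same := uniq_mu _ _ repl atl supl repu atu supu.
    have := Il (2 * s).+1; rewrite (eq_measure_integral muu); last first.
      by move=> B mB _; exact: same.
    by rewrite Iu -lE// -uE// /ext_mom eqxx => -[].
  + have [x1 [i1 c1 p1 x101 E1]] := atomic_measure_quadrature rd rep1 at1 sup1.
    have [x2 [i2 c2 p2 x201 E2]] := atomic_measure_quadrature rd rep2 at2 sup2.
    have [k kr|t tE] := @atoms_perm _ _ x1 x2 (fun i => mom y (lagr x1 i))
        (fun i => mom y (lagr x2 i)) i1 p1.
      (* Only order [2 * s + 1] lies beyond the data, and [l = u] forces its value for both
         measures. *)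
      have [kd|dk] := leqP k d; first by rewrite -E1// -E2.
      have -> : k = (2 * s).+1 by move: kr dk; rewrite rE /d; lia.
      by rewrite !(bounds rE lu)// => i; exact: ltW.
    exact: (same_measure_perm rd i1 i2 rep1 c1 rep2 c2 tE).
- split; first by exists (fun i => atom_vec d (w i) (x i)).
  move=> n v [v0 AE]; apply: (rk_min n (fun=> 1) (fun i => v i 0 0 + v i 1 0) (fun i => v i 1 0)).
  by move=> k kd; rewrite /y (Bvec_cp AE)//; apply: eq_bigr => i _; rewrite mul1r.
- move=> rs; apply: (cp_dec_unique_of_moments d0 x_inj w0) => v cv k kr.
  have kd : (k <= d)%N by move: kr rs; rewrite /d; lia.
  by rewrite -yE//; exact: cp_dec_quadrature.
- move=> rE; split=> [uniq_cp|lu].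
  (* The decompositions built from [l] and [u] agree up to order; reading back weights and nodes
     equates their moments of order [2 * s + 1]. *)
  + have [xl [wl [xl_inj wl0 xl01 lE]]] := extl rE l (or_introl erefl).
    have [xu [wu [xu_inj wu0 xu01 uE]]] := extl rE u (or_intror erefl).
    have cl : cp_dec A (fun i => atom_vec d (wl i) (xl i)).
      by apply: quadrature_cp_dec => // k kd; rewrite -lE ?leqW// ext_mom_id.
    have cu : cp_dec A (fun i => atom_vec d (wu i) (xu i)).
      by apply: quadrature_cp_dec => // k kd; rewrite -uE ?leqW// ext_mom_id.
    have [t tE] := uniq_cp _ _ cl cu.
    have wt i : wu i = wl (t i).
      by rewrite -(weight_atom_vec d0 (xu i) (ltW (wu0 i))) tE weight_atom_vec// ltW.
    have xt i : xu i = xl (t i).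
      by rewrite -(node_atom_vec d (xu i) (wu0 i)) tE node_atom_vec.
    have := uE (2 * s).+1 (leqnn _); have := lE (2 * s).+1 (leqnn _).
    rewrite /ext_mom eqxx => -> ->; rewrite (reindex_inj (@perm_inj _ t))/=.
    by apply: eq_bigr => i _; rewrite wt xt.
  + apply: (cp_dec_unique_of_moments d0 x_inj w0) => v cv k kr.
    have [kd|dk] := leqP k d; first by rewrite -yE//; exact: cp_dec_quadrature.
    have -> : k = (2 * s).+1 by move: kr dk; rewrite rE /d; lia.
    rewrite !(bounds rE lu)// => [i|i|j jd|i].
    * by case: (cv.1 i) => a b; exact: weight_ge0.
    * by case: (cv.1 i) => a b; exact: node01.
    * exact: cp_dec_quadrature.
    * exact: ltW.
Qed.
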